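(* Let $X$ be a compact Hausdorff space, and let $\mathcal H_\alpha$, $\{k_x^\alpha\}_{x\in X}$, $\nu_\alpha$ be as described in the context, with each $\mathcal H_\alpha$ finite-dimensional. Assume that $d\nu_\alpha=c(\alpha)\,d\nu$ with $c(\alpha)=\dim\mathcal H_\alpha$ and $\nu$ a finite Radon measure on $X$ independent of $\alpha$, and that for every $x\in X$ and every neighborhood $U$ of $x$, $\int_{X\setminus U}|\langle k_x^\alpha,k_y^\alpha\rangle_\alpha|^2\,d\nu_\alpha(y)\to0$ as $\alpha\to\infty$. Let $\sigma\in L^1(X,\nu)$ be non-negative. Then $$\lim_{\alpha\to\infty}\frac1{c(\alpha)}\operatorname{Tr}\bigl(\log(T_\sigma^\alpha)\bigr)=\int_X\log\sigma(x)\,d\nu(x),$$ where both sides are understood in the extended real sense. In particular, the right-hand side belongs to $[-\infty,\infty)$.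
   Context: For each value of a parameter $\alpha$ (limits are taken as $\alpha\to\infty$), $\mathcal H_\alpha$ is a Hilbert space with inner product $\langle\cdot,\cdot\rangle_\alpha$, and $\{k_x^\alpha:x\in X\}\subset\mathcal H_\alpha$ is a normalized continuous Parseval frame with frame Radon measure $\nu_\alpha$ on $X$: $\|k_x^\alpha\|_\alpha=1$ for all $x$, the functions $x\mapsto\langle f,k_x^\alpha\rangle_\alpha$ are Borel measurable, and $f=\int_X\langle f,k_x^\alpha\rangle_\alpha k_x^\alpha\,d\nu_\alpha(x)$ weakly for every $f\in\mathcal H_\alpha$. The Toeplitz operator is $T_\sigma^\alpha f=\int_X\sigma(x)\langle f,k_x^\alpha\rangle_\alpha k_x^\alpha\,d\nu_\alpha(x)$ (weakly defined), which is positive semidefinite for $\sigma\ge0$. $\operatorname{Tr}(\log T_\sigma^\alpha)=\sum_j\log\lambda_j$, the sum over the eigenvalues of $T_\sigma^\alpha$ with multiplicity, with the convention $\log0=-\infty$ (so that it equals $\log\det T_\sigma^\alpha$); likewise $\log\sigma(x)=-\infty$ where $\sigma(x)=0$. *)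

(* Defs.v *)
From HB Require Import structures.
From mathcomp Require Import all_boot all_order all_algebra.
From mathcomp Require Import complex.
From mathcomp Require Import all_classical all_reals all_analysis.

Set Implicit Arguments.
Unset Strict Implicit.
Unset Printing Implicit Defensive.

Import Order.TTheory GRing.Theory Num.Theory.
Import numFieldNormedType.Exports.

Local Open Scope classical_set_scope.
Local Open Scope ring_scope.

Definition borel (T : ptopologicalType) : measurableType _ :=
  g_sigma_algebraType (@open T).

Definition radon_measure (R : realType) (X : ptopologicalType)
    (mu : {measure set (borel X) -> \bar R}) : Prop :=
  [/\ forall K : set X, compact K -> (mu K < +oo)%E,
      forall B : set (borel X), measurable B ->
        mu B = ereal_inf [set mu U | U in [set U : set X | open U /\ B `<=` U]]
    & forall U : set X, open U ->
        mu U = ereal_sup [set mu K | K in [set K : set X | compact K /\ K `<=` U]]].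

Section weak_integral.
Variables (R : realType) (d : measure_display) (T : measurableType d).
Variable mu : {measure set T -> \bar R}.

Definition cintegrable (h : T -> R[i]) : Prop :=
  mu.-integrable [set: T] (fun x => (complex.Re (h x))%:E) /\
  mu.-integrable [set: T] (fun x => (complex.Im (h x))%:E).

Definition cintegral (h : T -> R[i]) : R[i] :=
  Complex (\int[mu]_(x in [set: T]) complex.Re (h x))
          (\int[mu]_(x in [set: T]) complex.Im (h x)).

Variables (H : vectType R[i]) (ip : {dot H for Num.conj}).

Definition is_weak_integral (F : T -> H) (v : H) : Prop :=
  forall g : H, cintegrable (fun x => ip (F x) g) /\
    ip v g = cintegral (fun x => ip (F x) g).

(* Since [ip] is definite, a weak integral is unique when it exists; the value
   is 0 when there is none. *)
Definition weak_integral (F : T -> H) : H :=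
  xget 0 [set v | is_weak_integral F v].

End weak_integral.

(* [ip] is linear in its first argument and conjugate-linear in its second;
   [R[i]^o] carries the usual topology of the complex plane, given by the
   modulus. *)
Record normalized_parseval_frame (R : realType) (X : ptopologicalType)
    (H : vectType R[i]) (ip : {dot H for Num.conj})
    (mu : {measure set (borel X) -> \bar R}) (k : X -> H) : Prop :=
  NormalizedParsevalFrame {
    frame_radon : radon_measure mu ;
    frame_normalized : forall x : X, ip (k x) (k x) = 1 ;
    frame_measurable : forall f : H,
      measurable_fun [set: borel X] (fun x : borel X => ip f (k x) : borel R[i]^o) ;
    frame_reconstruction : forall f : H,
      is_weak_integral mu ip (fun x : borel X => ip f (k x) *: k x) f }.

(* [linfun] bundles a function as an element of ['End(H)]; here the bundled
   function is linear whenever the weak integrals exist for all [f]. *)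
Definition toeplitz (R : realType) (X : ptopologicalType) (H : vectType R[i])
    (ip : {dot H for Num.conj}) (mu : {measure set (borel X) -> \bar R})
    (k : X -> H) (sigma : X -> R) : 'End(H) :=
  linfun (fun f : H => weak_integral mu ip
    (fun x : borel X => ((sigma x)%:C%C * ip f (k x)) *: k x)).

Section trace_log.
Variables (R : realType) (H : vectType R[i]).

(* The roots of the characteristic polynomial, with multiplicity. *)
Definition eigenvalues (T : 'End(H)) : seq R[i] :=
  sval (closed_field_poly_normal
          (char_poly (passmx.mxof (vbasis fullv) (vbasis fullv) T))).

(* Meant for positive semidefinite [T], whose eigenvalues are nonnegative
   reals; [lne 0 = -oo]. *)
Definition trace_log (T : 'End(H)) : \bar R :=
  (\sum_(z <- eigenvalues T) lne (complex.Re z)%:E)%E.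

End trace_log.

(* Main.v *)
(** For positive numbers [log a <= log t + a / t - 1], with equality at [a = t].
    Let [e_j] be an orthonormal eigenbasis of the Toeplitz operator, with
    eigenvalues [lam_j], and put [w_j x = |<e_j, k_x>|^2].  The Parseval property
    gives [sum_j w_j = 1], [int w_j dnu_alpha = 1],
    [lam_j = int sigma w_j dnu_alpha], and
    [sum_j lam_j w_j x = int sigma(y) |<k_x, k_y>|^2 dnu_alpha(y)], the Berezin
    transform of [sigma] at [x].

    Integrating the tangent inequality for [a = sigma x], [t = lam_j] against
    [w_j] gives [int log sigma dnu <= c^-1 Tr log T] for every [alpha].  The
    inequality for [a = lam_j], [t = s x], where [s] is bounded below by a positive
    constant, gives
    [c^-1 Tr log T <= int log s dnu - 1 + int sigma . B(1/s) dnu], where [B] is the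
    Berezin transform, which is self-adjoint.  Localization yields
    [limsup int sigma . B g dnu <= int sigma g dnu], first for indicators of closed
    sets, where [B g] tends to 0 off the set, then for indicators of Borel sets by
    regularity of [nu] and for bounded [g] by uniform approximation.  With
    [s = max(sigma, eps)] the bound becomes [int log s dnu], and [eps] tends
    to 0 by monotone convergence. *)

Require Import Defs.
From HB Require Import structures.
From mathcomp Require Import all_boot all_order all_algebra.
From mathcomp Require Import complex.
From mathcomp Require Import all_classical all_reals all_analysis.
From mathcomp Require Import measurable_realfun ring lra.

Import Order.TTheory GRing.Theory Num.Theory.
Import numFieldNormedType.Exports.

Local Open Scope classical_set_scope.
Local Open Scope ring_scope.

(** * Spectral theorem for definite sesquilinear forms *)

Section dot_product.
Context {C : numClosedFieldType} {H : vectType C} (ip : {dot H for Num.conj}).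
Implicit Types (f g : H).

Lemma dot_conj f g : ip f g = (ip g f)^*.
Proof. by rewrite hermC expr0 mul1r. Qed.

Lemma dotZl a f g : ip (a *: f) g = a * ip f g.
Proof. exact: linearZl_LR. Qed.

Lemma dotDl f g h : ip (f + g) h = ip f h + ip g h.
Proof. exact: linearDl. Qed.

Lemma dotZr a f g : ip f (a *: g) = a^* * ip f g.
Proof. exact: linearZr_LR. Qed.

Lemma dot_suml (I : finType) (a : I -> C) (u : I -> H) g :
  ip (\sum_i a i *: u i) g = \sum_i a i * ip (u i) g.
Proof. by rewrite linear_sumlz; apply: eq_bigr => i _; rewrite linearZl_LR. Qed.

Lemma dot_sumr (I : finType) (a : I -> C) (u : I -> H) g :
  ip g (\sum_i a i *: u i) = \sum_i (a i)^* * ip g (u i).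
Proof. by rewrite linear_sumr; apply: eq_bigr => i _; rewrite linearZr_LR. Qed.

Lemma dot_eq0 f : ip f f = 0 -> f = 0.
Proof.
move=> f0; apply/eqP; apply/negPn/negP => /(neq0_dnorm_gt0 (s := ip)).
by rewrite f0 ltxx.
Qed.

Lemma dot_inj f g : (forall h, ip f h = ip g h) -> f = g.
Proof.
move=> fg; apply/eqP; rewrite -subr_eq0; apply/eqP/dot_eq0.
by rewrite linearBl /= fg subrr.
Qed.

Definition orthonormal_family (n : nat) (e : 'I_n -> H) :=
  forall i j, ip (e i) (e j) = (i == j)%:R.

(** The matrix of the form [ip (F f) g] on [b] is Hermitian, so the spectral theorem for matrices
    diagonalizes it by a unitary [P]. The family [b] is arbitrary: the lemma is applied to the
    identity on a mere basis, which yields orthogonal vectors, and then to an operator on an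
    orthonormal basis, which yields eigenvectors. *)
Lemma diagonalize_form (n : nat) (b : 'I_n -> H) (F : H -> H) :
  (forall f g, ip (F f) g = (ip (F g) f)^*) ->
  (forall a u, F (\sum_(i < n) a i *: u i) = \sum_(i < n) a i *: F (u i)) ->
  exists2 P : 'M[C]_n, P \is unitarymx &
    forall i j, i != j ->
      ip (F (\sum_l P i l *: b l)) (\sum_l P j l *: b l) = 0.
Proof.
move=> hermF linF.
pose G := \matrix_(i, j) ip (F (b i)) (b j).
have Gherm : G \is hermsymmx.
  apply/is_hermitianmxP; rewrite expr0 scale1r.
  by apply/matrixP => i j; rewrite !mxE hermF.
have /hermitian_normalmx/orthomx_spectralP GE := Gherm.
exists (spectralmx G); first exact: spectral_unitarymx.
set P := spectralmx G in GE *.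
have PU : P \is unitarymx by exact: spectral_unitarymx.
have /unitarymxP PP := PU.
move=> i j ij.
(* The value of the form on rows [i] and [j] of [P] is an entry of [P G] times the adjoint of [P],
   which is diagonal. *)
have <- : (P *m G *m (map_mx Num.conj P^T)) i j = 0.
  rewrite GE invmx_unitary // !mulmxA PP mul1mx.
  by rewrite -mulmxA PP mulmx1 mxE (negbTE ij).
rewrite linF dot_suml mxE.
under eq_bigr => l _ do rewrite dot_sumr.
under [RHS]eq_bigr => l _ do rewrite mxE mulr_suml.
rewrite [RHS]exchange_big /=; apply: eq_bigr => l _; rewrite mulr_sumr.
by apply: eq_bigr => m _; rewrite !mxE mulrAC mulrA.
Qed.

Lemma unitary_comb_orthonormal n (e : 'I_n -> H) (P : 'M[C]_n) :
  orthonormal_family n e -> P \is unitarymx ->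
  orthonormal_family n (fun i => \sum_l P i l *: e l).
Proof.
move=> eo /unitarymxP /matrixP PU i j.
rewrite dot_suml; have := PU i j; rewrite !mxE => <-.
apply: eq_bigr => l _; rewrite dot_sumr (bigD1 l) //= big1 ?addr0.
  by rewrite eo eqxx mulr1 !mxE.
by move=> m ml; rewrite eo eq_sym (negbTE ml) mulr0.
Qed.

Lemma orthonormal_free n (e : n.-tuple H) :
  orthonormal_family n (fun i => e`_i) -> free e.
Proof.
move=> eo; apply/freeP => a a0 i.
have := congr1 (fun v => ip v e`_i) a0; rewrite linear0l dot_suml.
rewrite (bigD1 i) //= big1 ?addr0 => [|j ji]; first by rewrite eo eqxx mulr1.
by rewrite eo (negbTE ji) mulr0.
Qed.

Let n := \dim {: H}.

Lemma orthonormal_basis (e : n.-tuple H) :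
  orthonormal_family n (fun i => e`_i) -> basis_of fullv e.
Proof.
move=> eo; rewrite basisEfree (orthonormal_free _ _ eo) subvf size_tuple.
exact: leqnn.
Qed.

Lemma orthonormal_expand (e : 'I_n -> H) f :
  orthonormal_family n e -> f = \sum_i ip f (e i) *: e i.
Proof.
move=> eo; pose t := [tuple e i | i < n].
have tE (i : 'I_n) : t`_i = e i by rewrite -tnth_nth tnth_mktuple.
have tB : basis_of fullv t.
  by apply: orthonormal_basis => i j; rewrite !tE eo.
rewrite [LHS](coord_basis tB) ?memvf //.
apply: eq_bigr => i _; rewrite tE; congr (_ *: _).
rewrite [in RHS](coord_basis tB (memvf f)) dot_suml (bigD1 i) //= big1.
  by rewrite tE eo eqxx mulr1 addr0.
by move=> j ji; rewrite tE eo (negbTE ji) mulr0.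
Qed.

(** Instead of Gram-Schmidt, the Gram matrix of a basis is diagonalized and the resulting orthogonal
    vectors are normalized. *)
Lemma exists_orthonormal : exists e : 'I_n -> H, orthonormal_family n e.
Proof.
pose b (i : 'I_n) := (vbasis fullv : seq H)`_i.
have [||P PU Po] := diagonalize_form _ b idfun; first exact: dot_conj.
  by [].
pose v i := \sum_l P i l *: b l.
have vb : free (vbasis (fullv : {vspace H})) by rewrite (basis_free (vbasisP _)).
(* By freeness of the basis, [v i = 0] would make row [i] of the unitary matrix [P] vanish. *)
have v0 i : v i != 0.
  apply/eqP => vi0.
  have Pi l : P i l = 0 by have /freeP := vb; apply; exact: vi0.
  have /unitarymxP/matrixP/(_ i i) := PU.
  rewrite !mxE eqxx big1 => [|l _]; last by rewrite Pi mul0r.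
  by move/eqP; rewrite eq_sym oner_eq0.
have vpos i : 0 < ip (v i) (v i) by exact: neq0_dnorm_gt0.
exists (fun i => (sqrtC (ip (v i) (v i)))^-1 *: v i) => i j.
rewrite dotZl dotZr.
have [<-|ij] := eqVneq i j; last first.
  by rewrite (Po _ _ ij) !mulr0.
have s0 : 0 < sqrtC (ip (v i) (v i)) by rewrite sqrtC_gt0.
rewrite geC0_conj; last by rewrite invr_ge0 ltW.
rewrite -[X in _ * (_ * X)]sqrtCK expr2 mulKf ?gt_eqF // mulVf ?gt_eqF //.
Qed.

(** In an orthonormal basis that diagonalizes the form of [T], the expansion of [T (e j)] keeps only
    its [j]-th term. *)
Lemma selfadjoint_eigenbasis (T : 'End(H)) :
  (forall f g, ip (T f) g = ip f (T g)) ->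
  exists e : 'I_n -> H, orthonormal_family n e /\
    forall j, T (e j) = ip (T (e j)) (e j) *: e j.
Proof.
move=> Tsa; have [b bo] := exists_orthonormal.
have [f g||P PU Po] := diagonalize_form _ b T.
- by rewrite Tsa dot_conj.
- by move=> a u; rewrite linear_sum; apply: eq_bigr => i _; rewrite linearZ.
exists (fun i => \sum_l P i l *: b l).
have eo := unitary_comb_orthonormal _ _ _ bo PU.
split=> // j; rewrite [LHS](orthonormal_expand _ _ eo) (bigD1 j) //= -[RHS]addr0.
by congr (_ + _); apply: big1 => i ij; rewrite (Po j i) ?scale0r // eq_sym.
Qed.

(** Links the eigenvalues, defined through the matrix of [T] in [vbasis fullv], to an eigenbasis:
    the two matrices are similar, and the determinants of the change of basis and its inverse
    cancel. *)
Lemma char_poly_eigenbasis (T : 'End(H)) (e : 'I_n -> H) (z : 'I_n -> C) :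
  orthonormal_family n e -> (forall j, T (e j) = z j *: e j) ->
  char_poly (passmx.mxof (vbasis fullv) (vbasis fullv) T) =
  \prod_j ('X - (z j)%:P).
Proof.
move=> eo Te; pose t := [tuple e i | i < n].
have tE (i : 'I_n) : t`_i = e i by rewrite -tnth_nth tnth_mktuple.
have tB : basis_of fullv t.
  by apply: orthonormal_basis => i j; rewrite !tE eo.
have vB := vbasisP (fullv : {vspace H}).
set v := vbasis fullv in vB *.
have TE : passmx.mxof t t T = diag_mx (\row_j z j).
  apply/matrixP => i j; rewrite !mxE /= passmx.vecof_delta tE Te -tE linearZ /=.
  by rewrite coord_free ?(basis_free tB) // eq_sym mulr_natr.
have <- : char_poly (passmx.mxof t t T) = \prod_j ('X - (z j)%:P).
  rewrite TE char_poly_trig ?diag_mx_is_trig //.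
  by apply: eq_bigr => j _; rewrite !mxE eqxx.
have -> : passmx.mxof v v T =
    passmx.mxof v t \1%VF *m passmx.mxof t t T *m passmx.mxof t v \1%VF.
  by rewrite -!passmx.mxof_comp // comp_lfun1l comp_lfun1r.
have Q1 : passmx.mxof t v \1%VF *m passmx.mxof v t \1%VF = 1%:M.
  by rewrite -passmx.mxof_comp // comp_lfun1l passmx.mxof1 // (basis_free tB).
set Q := passmx.mxof v t \1%VF in Q1 *; set Q' := passmx.mxof t v _ in Q1 *.
set D := passmx.mxof t t T.
have Q2 : Q *m Q' = 1%:M by exact: mulmx1C.
rewrite /char_poly /char_poly_mx.
have QP : map_mx (@polyC C) Q *m map_mx polyC Q' = 1%:M.
  by rewrite -map_mxM Q2 map_mx1.
have -> : 'X%:M - map_mx polyC (Q *m D *m Q') =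
   map_mx (@polyC C) Q *m ('X%:M - map_mx polyC D) *m map_mx polyC Q'.
  rewrite mulmxBr mulmxBl -!map_mxM; congr (_ - _).
  by rewrite scalar_mxC -mulmxA QP mulmx1.
by rewrite !det_mulmx mulrAC -det_mulmx QP det1 mul1r.
Qed.

End dot_product.

(** * Integration tools *)

Section log.
Context {R : realType}.
Implicit Types a t : R.

Lemma ln_tangent a t : 0 < a -> 0 < t -> ln a <= ln t + a / t - 1.
Proof.
move=> a0 t0; have at0 : 0 < a / t by rewrite divr_gt0.
have := @le_ln1Dx R (a / t - 1); rewrite addrCA subrr addr0 ln_div ?posrE //.
have -> : -1 < a / t - 1 by lra.
move=> /(_ isT); lra.
Qed.

Lemma ln_lt_id t : 0 < t -> ln t <= t.
Proof. by move=> t0; apply/ltW/ln_sublinear. Qed.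

Lemma le_all_eqNy (x : \bar R) : (forall A : R, (x <= A%:E)%E) -> x = -oo%E.
Proof.
case: x => [r| |] // H; last by have := H 0.
by exfalso; move: (H (r - 1)) => {H}; rewrite lee_fin => h; lra.
Qed.

End log.

Section integral_tools.
Context {R : realType} {d : measure_display} {T : measurableType d}.
Variable mu : {measure set T -> \bar R}.

Lemma measurable_lne (f : T -> R) : measurable_fun setT f ->
  measurable_fun setT (fun x => lne (f x)%:E).
Proof.
move=> mf; apply: measurable_fun_ifT => /=.
- by apply: measurable_fun_ler.
- exact: measurable_cst.
- by apply/measurable_EFinP; apply: measurableT_comp.
Qed.

(** On positive reals the inverse is [expR (- ln _)], a composition of measurable functions. *)
Lemma measurable_inv_gt0 (f : T -> R) : (forall x, 0 < f x) ->
  measurable_fun setT f -> measurable_fun setT (fun x => (f x)^-1).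
Proof.
move=> f0 mf; rewrite (_ : (fun _ => _) = fun x => expR (- ln (f x))).
  apply: measurableT_comp => //; apply: measurableT_comp => //.
  exact: measurableT_comp.
by apply/funext => x; rewrite expRN lnK ?posrE.
Qed.

(** Positive and negative parts are compared separately, so that the integrals may be infinite, as
    that of the logarithm of the symbol can be. *)
Lemma le_integral_measurable (f g : T -> \bar R) :
  measurable_fun setT f -> measurable_fun setT g -> (forall x, (f x <= g x)%E) ->
  (\int[mu]_x f x <= \int[mu]_x g x)%E.
Proof.
move=> mf mg fg; rewrite integralE [leRHS]integralE; apply: leeB.
- apply: ge0_le_integral => //; [exact: measurable_funepos|exact: measurable_funepos|].
  by move=> x _; rewrite !funeposE le_max2.
- apply: ge0_le_integral => //; [exact: measurable_funeneg|exact: measurable_funeneg|].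
  by move=> x _; rewrite !funenegE le_max2 // leeN2.
Qed.

Lemma integrable_scale (k : R) (f : T -> R) : mu.-integrable setT (EFin \o f) ->
  mu.-integrable setT (EFin \o (fun x => k * f x)).
Proof. exact: (@integrableZl _ _ _ mu _ measurableT k (EFin \o f)). Qed.

Lemma integrable_add (f g : T -> R) : mu.-integrable setT (EFin \o f) ->
  mu.-integrable setT (EFin \o g) -> mu.-integrable setT (EFin \o (fun x => f x + g x)).
Proof. exact: (@integrableD _ _ _ mu _ measurableT (EFin \o f) (EFin \o g)). Qed.

Lemma integrable_sub (f g : T -> R) : mu.-integrable setT (EFin \o f) ->
  mu.-integrable setT (EFin \o g) -> mu.-integrable setT (EFin \o (fun x => f x - g x)).
Proof. exact: (@integrableB _ _ _ mu _ measurableT (EFin \o f) (EFin \o g)). Qed.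

Lemma integrable_rsum (I : Type) (r : seq I) (h : I -> T -> R) :
  (forall i, mu.-integrable setT (EFin \o h i)) ->
  mu.-integrable setT (EFin \o (fun x => \sum_(i <- r) h i x)).
Proof.
move=> hi; rewrite /comp; under eq_fun do rewrite -sumEFin.
by apply: integrable_sum => // i _; exact: hi.
Qed.

Lemma Rintegral_rsum (I : Type) (r : seq I) (h : I -> T -> R) :
  (forall i, mu.-integrable setT (EFin \o h i)) ->
  \int[mu]_x (\sum_(i <- r) h i x) = \sum_(i <- r) \int[mu]_x h i x.
Proof.
move=> hi; elim: r => [|i r IH].
  by rewrite big_nil -[RHS](@Rintegral_set0 _ _ _ mu (fun=> 0)) /Rintegral;
   under eq_integral do rewrite big_nil; rewrite integral0 integral_set0.
rewrite big_cons -IH -RintegralD //; last exact: integrable_rsum.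
by apply: eq_Rintegral => x _; rewrite big_cons.
Qed.

Lemma bounded_in (h : T -> R) (M : R) : (forall x, `|h x| <= M) ->
  [bounded h x | x in [set: T]].
Proof.
move=> hM; exists M; split; first exact: num_real.
by move=> y My x _ /=; apply: le_trans (hM x) (ltW My).
Qed.

Lemma integrable_mul_bounded (f h : T -> R) (M : R) :
  mu.-integrable setT (EFin \o f) -> measurable_fun setT h -> (forall x, `|h x| <= M) ->
  mu.-integrable setT (EFin \o (fun x => f x * h x)).
Proof.
move=> fi mh hM; rewrite (_ : EFin \o _ = (EFin \o f) \* (EFin \o h))%E //.
by apply: integrableMl => //; exact: bounded_in hM.
Qed.

Lemma EFin_Rintegral (f : T -> R) : mu.-integrable setT (EFin \o f) ->
  (\int[mu]_x (f x)%:E = (\int[mu]_x f x)%:E)%E.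
Proof. by move=> fi; rewrite fineK //; exact: integrable_fin_num. Qed.

Lemma integrable_measurable (f : T -> R) : mu.-integrable setT (EFin \o f) ->
  measurable_fun setT f.
Proof. by move=> /measurable_int /measurable_EFinP. Qed.
End integral_tools.

(** * Real and imaginary parts of complex numbers *)

Section Complex.
Context {R : realType}.
Implicit Types z w : R[i].

Lemma cReM z w : complex.Re (z * w) = complex.Re z * complex.Re w - complex.Im z * complex.Im w.
Proof. by case: z w => [a b] [c d]. Qed.

Lemma cImM z w : complex.Im (z * w) = complex.Re z * complex.Im w + complex.Im z * complex.Re w.
Proof. by case: z w => [a b] [c d]. Qed.

Lemma Re_realM (r : R) z : complex.Re (r%:C%C * z) = r * complex.Re z.
Proof. by case: z => [a b] /=; rewrite mul0r subr0. Qed.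

Lemma Im_realM (r : R) z : complex.Im (r%:C%C * z) = r * complex.Im z.
Proof. by case: z => [a b] /=; rewrite mul0r addr0. Qed.

Lemma cReD z w : complex.Re (z + w) = complex.Re z + complex.Re w.
Proof. by case: z w => [a b] [c d]. Qed.

Lemma cImD z w : complex.Im (z + w) = complex.Im z + complex.Im w.
Proof. by case: z w => [a b] [c d]. Qed.

Lemma cRe_conj z : complex.Re z^* = complex.Re z.
Proof. by case: z. Qed.

Lemma cIm_conj z : complex.Im z^* = - complex.Im z.
Proof. by case: z. Qed.

Lemma complex_ext z w : complex.Re z = complex.Re w -> complex.Im z = complex.Im w -> z = w.
Proof. by case: z w => [a b] [c d] /= -> ->. Qed.

Lemma cRe_sum (I : Type) (r : seq I) (F : I -> R[i]) :
  complex.Re (\sum_(i <- r) F i) = \sum_(i <- r) complex.Re (F i).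
Proof. by apply: (big_morph (@complex.Re R) cReD). Qed.

Lemma cIm_sum (I : Type) (r : seq I) (F : I -> R[i]) :
  complex.Im (\sum_(i <- r) F i) = \sum_(i <- r) complex.Im (F i).
Proof. by apply: (big_morph (@complex.Im R) cImD). Qed.

Lemma Re_sqr_norm z : complex.Re (`|z| ^+ 2) = complex.Re z ^+ 2 + complex.Im z ^+ 2.
Proof. by rewrite -add_Re2_Im2. Qed.

Lemma Re_conjM z : complex.Re (z * z^*) = complex.Re (`|z| ^+ 2).
Proof. by rewrite normCK. Qed.

Lemma Re_sqr_normJ z : complex.Re (`|z^*| ^+ 2) = complex.Re (`|z| ^+ 2).
Proof. by rewrite norm_conjC. Qed.

Lemma Re_sqr_norm_ge0 z : 0 <= complex.Re (`|z| ^+ 2).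
Proof. by rewrite Re_sqr_norm addr_ge0 ?sqr_ge0. Qed.

End Complex.

(** * Linearity of complex-valued integrals *)

Section cintegral_theory.
Context {R : realType} {d : measure_display} {T : measurableType d}.
Variable mu : {measure set T -> \bar R}.
Implicit Types h : T -> R[i].

Lemma Re_cintegral h :
  complex.Re (cintegral mu h) = \int[mu]_(x in [set: T]) complex.Re (h x).
Proof. by []. Qed.

Lemma cintegrableD h1 h2 : cintegrable mu h1 -> cintegrable mu h2 ->
  cintegrable mu (fun x => h1 x + h2 x).
Proof.
move=> [r1 i1] [r2 i2]; split.
- by under eq_fun do rewrite cReD EFinD; apply: integrableD.
- by under eq_fun do rewrite cImD EFinD; apply: integrableD.
Qed.

Lemma cintegralD h1 h2 : cintegrable mu h1 -> cintegrable mu h2 ->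
  cintegral mu (fun x => h1 x + h2 x) = cintegral mu h1 + cintegral mu h2.
Proof.
move=> [r1 i1] [r2 i2]; apply: complex_ext => /=.
- by rewrite -RintegralD //; apply: eq_Rintegral => x _; rewrite cReD.
- by rewrite -RintegralD //; apply: eq_Rintegral => x _; rewrite cImD.
Qed.

Lemma cintegrableZ a h : cintegrable mu h -> cintegrable mu (fun x => a * h x).
Proof.
move=> [r1 i1]; split.
- under eq_fun do rewrite cReM EFinB !EFinM.
  by apply: integrableB => //; apply: integrableZl.
- under eq_fun do rewrite cImM EFinD !EFinM.
  by apply: integrableD => //; apply: integrableZl.
Qed.

Lemma cintegralZ a h : cintegrable mu h ->
  cintegral mu (fun x => a * h x) = a * cintegral mu h.
Proof.
move=> [r1 i1]; have iZ := @integrableZl _ _ _ mu _ (@measurableT _ T).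
have r1Z k := iZ k _ r1; have i1Z k := iZ k _ i1.
apply: complex_ext.
- rewrite cReM /= -!RintegralZl // -RintegralB //; [|exact: r1Z|exact: i1Z].
  by apply: eq_Rintegral => x _; rewrite cReM.
- rewrite cImM /= -!RintegralZl // -RintegralD //; [|exact: i1Z|exact: r1Z].
  by apply: eq_Rintegral => x _; rewrite cImM.
Qed.

Lemma cintegrable0 : cintegrable mu (fun=> 0).
Proof. by split; exact: integrable0. Qed.

Lemma cintegral0 : cintegral mu (fun=> 0) = 0.
Proof.
by apply: complex_ext; rewrite /= /Rintegral integral0.
Qed.

Lemma cintegrable_sum (I : Type) (r : seq I) (h : I -> T -> R[i]) :
  (forall i, cintegrable mu (h i)) -> cintegrable mu (fun x => \sum_(i <- r) h i x).
Proof.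
move=> hi; elim: r => [|i r IH].
  by under eq_fun do rewrite big_nil; exact: cintegrable0.
by under eq_fun do rewrite big_cons; exact: cintegrableD.
Qed.

Lemma cintegral_sum (I : Type) (r : seq I) (h : I -> T -> R[i]) :
  (forall i, cintegrable mu (h i)) ->
  cintegral mu (fun x => \sum_(i <- r) h i x) = \sum_(i <- r) cintegral mu (h i).
Proof.
move=> hi; elim: r => [|i r IH].
  by under eq_fun do rewrite big_nil; rewrite big_nil cintegral0.
under eq_fun do rewrite big_cons.
by rewrite cintegralD ?IH ?big_cons //; apply: cintegrable_sum.
Qed.

Lemma cintegral_conj h : cintegrable mu h ->
  cintegral mu (fun x => (h x)^*) = (cintegral mu h)^*.
Proof.
move=> [_ i1]; apply: complex_ext; rewrite ?cRe_conj ?cIm_conj /=.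
  by apply: eq_Rintegral => x _; rewrite cRe_conj.
rewrite -mulN1r -RintegralZl //.
by apply: eq_Rintegral => x _; rewrite cIm_conj mulN1r.
Qed.

End cintegral_theory.

(** * Toeplitz operators of a frame *)

Section measurable_complex.
Context {R : realType} {d : measure_display} {T : measurableType d}.
Implicit Types h : T -> R[i].

Lemma open_Re_gt (r : R) : open [set z : R[i]^o | r < complex.Re z].
Proof.
rewrite openE => z /= rz; rewrite /interior.
apply/nbhs_ballP; exists (complex.Re z - r)%:C%C => /=.
  by rewrite ltcR subr_gt0.
move=> w /=; rewrite -ball_normE /= => zw.
have := le_lt_trans (normc_ge_Re (z - w)) zw.
rewrite ltcR => /(le_lt_trans (ler_norm _)).
by case: z w {rz zw} => [a b] [c e] /=; rewrite ltrD2l ltrN2.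
Qed.

Lemma open_Im_gt (r : R) : open [set z : R[i]^o | r < complex.Im z].
Proof.
rewrite openE => z /= rz; rewrite /interior.
apply/nbhs_ballP; exists (complex.Im z - r)%:C%C => /=.
  by rewrite ltcR subr_gt0.
move=> w /=; rewrite -ball_normE /= => zw.
(* Multiplication by ['i] preserves the modulus and turns the imaginary part into minus a real part,
   so the bound of the real part by the modulus applies. *)
have zw' : `|(w - z) * 'i%C| < (complex.Im z - r)%:C%C.
  by rewrite normrM complexiE normCi mulr1 distrC.
have := le_lt_trans (normc_ge_Re _) zw'.
rewrite ltcR ReiNIm => /(le_lt_trans (ler_norm _)).
by case: z w {rz zw zw'} => [a b] [c e] /=; rewrite opprB ltrD2l ltrN2.
Qed.

Lemma measurable_Re h : measurable_fun setT (h : T -> borel R[i]^o) ->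
  measurable_fun setT (fun x => complex.Re (h x)).
Proof.
move=> mh; apply: (measurability (@RGenOInfty.G R) (RGenOInfty.measurableE R)).
move=> _ [_ [r ->] <-].
rewrite [X in measurable X](_ : _ = setT `&` h @^-1` [set z | r < complex.Re z]).
  by apply: mh => //; apply: sub_sigma_algebra; exact: open_Re_gt.
by apply/seteqP; split => x /=; rewrite in_itv /= andbT.
Qed.

Lemma measurable_Im h : measurable_fun setT (h : T -> borel R[i]^o) ->
  measurable_fun setT (fun x => complex.Im (h x)).
Proof.
move=> mh; apply: (measurability (@RGenOInfty.G R) (RGenOInfty.measurableE R)).
move=> _ [_ [r ->] <-].
rewrite [X in measurable X](_ : _ = setT `&` h @^-1` [set z | r < complex.Im z]).
  by apply: mh => //; apply: sub_sigma_algebra; exact: open_Im_gt.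
by apply/seteqP; split => x /=; rewrite in_itv /= andbT.
Qed.
End measurable_complex.

Section toeplitz.
Context {R : realType} {X : ptopologicalType} {H : vectType R[i]}.
Variables (ip : {dot H for Num.conj}) (mu : {measure set (borel X) -> \bar R}).
Variables (k : X -> H) (sigma : X -> R).
Hypothesis frame : normalized_parseval_frame ip mu k.
Hypothesis sigma_L1 : mu.-integrable [set: borel X] (fun x => (sigma x)%:E).
Let n := \dim {: H}.

Let meas_Re f : measurable_fun [set: borel X] (fun x : borel X => complex.Re (ip f (k x))).
Proof. by apply: measurable_Re; exact: frame_measurable frame f. Qed.

Let meas_Im f : measurable_fun [set: borel X] (fun x : borel X => complex.Im (ip f (k x))).
Proof. by apply: measurable_Im; exact: frame_measurable frame f. Qed.

(** Parseval's identity for the unit vector [k x]. *)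
Lemma sum_sqr_frame (e : 'I_n -> H) x : orthonormal_family ip n e ->
  \sum_j complex.Re (`|ip (e j) (k x)| ^+ 2) = 1.
Proof.
move=> eo; have := frame_normalized frame x.
rewrite {1}(orthonormal_expand ip e (k x) eo) dot_suml => /(congr1 (@complex.Re R)).
rewrite cRe_sum => E; rewrite -[RHS]/(complex.Re (1 : R[i])) -E.
by apply: eq_bigr => j _; rewrite (dot_conj ip (k x)) mulrC Re_conjM.
Qed.

Lemma measurable_sqr_frame f : measurable_fun [set: borel X]
  (fun x : borel X => complex.Re (`|ip f (k x)| ^+ 2)).
Proof.
under eq_fun do rewrite Re_sqr_norm.
by apply: measurable_funD; apply: measurable_funX.
Qed.

(** The frame gives measurability in one variable at a time. Expanding [k z.1] in an orthonormal
    basis makes the kernel a polynomial in functions of one variable, hence jointly measurable, as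
    Tonelli's theorem requires. *)
Lemma measurable_frame_kernel : measurable_fun [set: borel X * borel X]
  (fun z : borel X * borel X => complex.Re (`|ip (k z.1) (k z.2)| ^+ 2)).
Proof.
have [e eo] := exists_orthonormal ip.
have E (z : borel X * borel X) : ip (k z.1) (k z.2) =
    \sum_j (ip (e j) (k z.1))^* * ip (e j) (k z.2).
  rewrite {1}(orthonormal_expand ip e (k z.1) eo) dot_suml.
  by apply: eq_bigr => j _; rewrite -dot_conj.
have m1 f : measurable_fun [set: borel X * borel X]
    (fun z : borel X * borel X => complex.Re (ip f (k z.1))).
  exact: (measurableT_comp (meas_Re f) measurable_fst).
have m2 f : measurable_fun [set: borel X * borel X]
    (fun z : borel X * borel X => complex.Re (ip f (k z.2))).
  exact: (measurableT_comp (meas_Re f) measurable_snd).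
have m3 f : measurable_fun [set: borel X * borel X]
    (fun z : borel X * borel X => complex.Im (ip f (k z.1))).
  exact: (measurableT_comp (meas_Im f) measurable_fst).
have m4 f : measurable_fun [set: borel X * borel X]
    (fun z : borel X * borel X => complex.Im (ip f (k z.2))).
  exact: (measurableT_comp (meas_Im f) measurable_snd).
under eq_fun do rewrite Re_sqr_norm E cRe_sum cIm_sum.
apply: measurable_funD; apply: measurable_funX; apply: measurable_sum => j.
  under eq_fun do rewrite cReM cRe_conj cIm_conj.
  apply: measurable_funB; apply: measurable_funM => //.
  exact: measurableT_comp.
under eq_fun do rewrite cImM cRe_conj cIm_conj.
apply: measurable_funD; apply: measurable_funM => //.
exact: measurableT_comp.
Qed.

(** Each [|ip (e j) (k x)|] is at most 1, so the sum of the moduli of the coordinates of [f] is a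
    bound uniform in [x]. Products of such coefficients with an integrable symbol are then
    integrable. *)
Lemma bounded_frame_coef f : exists M : R, forall x, `|complex.Re (ip f (k x))| <= M /\
  `|complex.Im (ip f (k x))| <= M.
Proof.
have [e eo] := exists_orthonormal ip.
pose M := \sum_j complex.Re `|ip f (e j)|.
have fM x : `|ip f (k x)| <= M%:C%C.
  rewrite {1}(orthonormal_expand ip e f eo) dot_suml.
  apply: le_trans (ler_norm_sum _ _ _) _.
  have -> : M%:C%C = \sum_j `|ip f (e j)|.
    by rewrite rmorph_sum; apply: eq_bigr => j _; exact: RRe_real (normr_real _).
  apply: ler_sum => j _; rewrite normrM ler_piMr //.
  rewrite -(expr_le1 (n := 2)) // -[X in X <= _]RRe_real ?realX ?normr_real //.
  rewrite lecR -(sum_sqr_frame e x eo) (bigD1 j) //= lerDl sumr_ge0 // => i _.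
  exact: Re_sqr_norm_ge0.
exists M => x; split; rewrite -lecR (le_trans _ (fM x)) //.
  exact: normc_ge_Re.
have := normc_ge_Re (ip f (k x) * 'i%C).
by rewrite ReiNIm normrN normrM complexiE normCi mulr1.
Qed.

Lemma toeplitz_integrandE f g (x : borel X) :
  ip (((sigma x)%:C%C * ip f (k x)) *: k x) g =
  (sigma x)%:C%C * (ip f (k x) * (ip g (k x))^*).
Proof. by rewrite dotZl mulrA (dot_conj ip (k x) g). Qed.

Lemma cintegrable_toeplitz f g : cintegrable mu
  (fun x : borel X => (sigma x)%:C%C * (ip f (k x) * (ip g (k x))^*)).
Proof.
have [M fM] := bounded_frame_coef f; have [N gN] := bounded_frame_coef g.
split.

- pose b (x : borel X) : R := complex.Re (ip f (k x)) * complex.Re (ip g (k x)) +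
    complex.Im (ip f (k x)) * complex.Im (ip g (k x)).
  have -> : (fun x : borel X => (complex.Re ((sigma x)%:C%C * (ip f (k x) * (ip g (k x))^*)))%:E) =
    ((fun x => (sigma x)%:E) \* (EFin \o b))%E.
    apply/funext => x /=; rewrite -EFinM; congr EFin.
    by rewrite Re_realM cReM cRe_conj cIm_conj mulrN opprK.
  apply: integrableMl => //.
    by apply: measurable_funD; apply: measurable_funM.
  apply: (bounded_in _ (M * N + M * N)) => x.
  have [f1 f2] := fM x; have [g1 g2] := gN x.
  by rewrite (le_trans (ler_normD _ _)) // !normrM lerD // ler_pM.
- pose b (x : borel X) : R := complex.Im (ip f (k x)) * complex.Re (ip g (k x)) -
    complex.Re (ip f (k x)) * complex.Im (ip g (k x)).
  have -> : (fun x : borel X => (complex.Im ((sigma x)%:C%C * (ip f (k x) * (ip g (k x))^*)))%:E) =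
    ((fun x => (sigma x)%:E) \* (EFin \o b))%E.
    apply/funext => x /=; rewrite -EFinM; congr EFin.
    by rewrite Im_realM cImM cRe_conj cIm_conj mulrN addrC.
  apply: integrableMl => //.
    by apply: measurable_funB; apply: measurable_funM.
  apply: (bounded_in _ (M * N + M * N)) => x.
  have [f1 f2] := fM x; have [g1 g2] := gN x.
  by rewrite (le_trans (ler_normB _ _)) // !normrM lerD // ler_pM.
Qed.

Let F f := fun x : borel X => ((sigma x)%:C%C * ip f (k x)) *: k x.

Lemma cintegrable_dot_toeplitz f g : cintegrable mu (fun x => ip (F f x) g).
Proof.
by under eq_fun do rewrite toeplitz_integrandE; exact: cintegrable_toeplitz.
Qed.

Lemma integrable_symbol_sqr_frame f : mu.-integrable [set: borel X]
  (EFin \o (fun x => sigma x * complex.Re (`|ip f (k x)| ^+ 2))).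
Proof.
have [i1 _] := cintegrable_toeplitz f f.
apply: eq_integrable i1 => // x _ /=; congr EFin.
by rewrite Re_realM Re_conjM.
Qed.

(** Ensures that [weak_integral] is a true weak integral here and not its default value 0. *)
Lemma weak_integral_exists f : is_weak_integral mu ip (F f) (weak_integral mu ip (F f)).
Proof.
rewrite /weak_integral; case: xgetP => //.
have [e eo] := exists_orthonormal ip.
(* In finite dimension the weak integral is obtained by integrating coordinates in an orthonormal
   basis. *)
move=> /(_ (\sum_j cintegral mu (fun x => ip (F f x) (e j)) *: e j)) [].
move=> g; split; first exact: cintegrable_dot_toeplitz.
rewrite dot_suml [in RHS](orthonormal_expand ip e g eo).
transitivity (cintegral mu (fun x => \sum_j ip (e j) g * ip (F f x) (e j))); last first.
  congr cintegral; apply/funext => x; rewrite dot_sumr.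
  by apply: eq_bigr => j _; rewrite -dot_conj.
rewrite cintegral_sum => [|j]; last by apply: cintegrableZ; exact: cintegrable_dot_toeplitz.
apply: eq_bigr => j _; rewrite cintegralZ; last exact: cintegrable_dot_toeplitz.
by rewrite [RHS]mulrC.
Qed.

Let W f : H := weak_integral mu ip (F f).

Let W_linear : linear W.
Proof.
move=> a f g; apply: (dot_inj ip) => h.
have [i1 E1] := weak_integral_exists (a *: f + g) h.
have [i2 E2] := weak_integral_exists f h.
have [i3 E3] := weak_integral_exists g h.
rewrite E1 dotDl dotZl E2 E3 -cintegralZ // -cintegralD //; last exact: cintegrableZ.
congr cintegral; apply/funext => x.
rewrite /F !dotZl dotDl dotZl mulrDr mulrDl; congr (_ + _).
by rewrite !mulrA (mulrC a).
Qed.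

Let T := toeplitz ip mu k sigma.

(** The function bundled by [linfun] is recovered because it has been shown to be linear. *)
Lemma toeplitzE f : T f = weak_integral mu ip
  (fun x : borel X => ((sigma x)%:C%C * ip f (k x)) *: k x).
Proof.
pose WL : {linear H -> H} := HB.pack W
   (GRing.isSemilinear.Build _ _ _ _ W (GRing.semilinear_linear W_linear)).
exact: (lfunE WL f).
Qed.

Lemma dot_toeplitz f g : ip (T f) g =
  cintegral mu (fun x : borel X => (sigma x)%:C%C * (ip f (k x) * (ip g (k x))^*)).
Proof.
rewrite toeplitzE; have [_ ->] := weak_integral_exists f g.
congr cintegral; apply/funext => x.
exact: toeplitz_integrandE.
Qed.

Lemma toeplitz_selfadjoint f g : ip (T f) g = ip f (T g).
Proof.
rewrite (dot_conj _ f) !dot_toeplitz -cintegral_conj; last first.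
  exact: cintegrable_toeplitz.
congr cintegral.
apply/funext => x; rewrite !rmorphM /= conjCK; congr (_ * _); last exact: mulrC.
exact/esym/conjc_real.
Qed.

Lemma Re_dot_toeplitz f : complex.Re (ip (T f) f) =
  \int[mu]_(x in [set: borel X]) (sigma x * complex.Re (`|ip f (k x)| ^+ 2)).
Proof.
rewrite dot_toeplitz Re_cintegral; apply: eq_Rintegral => x _.
by rewrite Re_realM Re_conjM.
Qed.

(** The weak reconstruction formula for [f], tested against [f] itself. *)
Lemma integral_sqr_frame f :
  (\int[mu]_(x in [set: borel X]) (complex.Re (`|ip f (k x)| ^+ 2))%:E =
  (complex.Re (ip f f))%:E)%E.
Proof.
have [[i1 _] E] := frame_reconstruction frame f f.
rewrite E Re_cintegral -[LHS]fineK; last first.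
  apply: integrable_fin_num => //; apply: eq_integrable i1 => // x _.
  by rewrite dotZl (dot_conj ip (k x)) Re_conjM.
congr EFin; apply: eq_Rintegral => x _.
by rewrite dotZl (dot_conj ip (k x)) Re_conjM.
Qed.

Lemma toeplitz_spectral_data :
  exists (e : 'I_n -> H) (lam : 'I_n -> R),
  [/\ orthonormal_family ip n e,
    (forall j, lam j = \int[mu]_(x in [set: borel X]) (sigma x * complex.Re (`|ip (e j) (k x)| ^+ 2))),
    (forall x, \sum_j lam j * complex.Re (`|ip (e j) (k x)| ^+ 2) =
      \int[mu]_(y in [set: borel X]) (sigma y * complex.Re (`|ip (k x) (k y)| ^+ 2))) &
    trace_log T = (\sum_j lne (lam j)%:E)%E].
Proof.
have [e [eo Te]] := selfadjoint_eigenbasis ip T toeplitz_selfadjoint.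
have realT f : (complex.Re (ip (T f) f))%:C%C = ip (T f) f.
  by rewrite RRe_real // CrealE -dot_conj toeplitz_selfadjoint.
exists e, (fun j => complex.Re (ip (T (e j)) (e j))); split => //.
- by move=> j; exact: Re_dot_toeplitz.
- move=> x; rewrite -Re_dot_toeplitz.
  (* The number [ip (T (k x)) (k x)] is computed twice: as the integral of the symbol against the
     kernel, and through the eigenbasis. *)
  have -> : T (k x) = \sum_j (ip (k x) (e j) * ip (T (e j)) (e j)) *: e j.
    rewrite {1}(orthonormal_expand ip e (k x) eo) linear_sum.
    by apply: eq_bigr => j _; rewrite linearZ /= {1}Te scalerA.
  rewrite dot_suml cRe_sum; apply: eq_bigr => j _.
  rewrite -[X in _ * X * _]realT mulrAC.
  rewrite [X in _ = complex.Re X]mulrC [RHS]Re_realM; congr (_ * _).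
  by rewrite (dot_conj ip (k x)) [X in _ = complex.Re X]mulrC Re_conjM.
- rewrite /trace_log /eigenvalues; case: closed_field_poly_normal => s /=.
  rewrite (monicP (char_poly_monic _)) scale1r.
  rewrite (char_poly_eigenbasis ip T e _ eo Te) => sE.
  (* The list [eigenvalues] is an unspecified enumeration of roots; unique factorization determines
     it up to permutation, which the sum does not see. *)
  rewrite (perm_big [seq ip (T (e j)) (e j) | j <- enum 'I_n]) /=.
    by rewrite big_map big_enum.
  apply: prod_XsubC_eq; rewrite -sE big_map big_enum.
  by [].
Qed.
End toeplitz.

(** * Trace bounds from the tangent inequality *)

Set Implicit Arguments.
(** A symmetric Markov kernel: for every [x], the density [c K x y] in [y] defines a probability
    measure. *)
Record berezin_kernel (R : realType) (d : measure_display) (T : measurableType d)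
    (nu : {measure set T -> \bar R}) (c : R) (K : T -> T -> R) : Prop := BerezinKernel {
  bk_pos : 0 < c ;
  bk_meas : measurable_fun setT (fun z : T * T => K z.1 z.2) ;
  bk_ge0 : forall x y, 0 <= K x y ;
  bk_sym : forall x y, K x y = K y x ;
  bk_int : forall x, (c%:E * \int[nu]_y (K x y)%:E = 1)%E }.

(* In the application [w j x = |<e_j, k_x>|^2] for an orthonormal eigenbasis [e]
   of the Toeplitz operator, [lam] lists its eigenvalues, [n] is the dimension
   and [K x y = |<k_x, k_y>|^2]. *)
Record spectral_data (R : realType) (d : measure_display) (T : measurableType d)
    (nu : {measure set T -> \bar R}) (sigma : T -> R) (n : nat)
    (w : 'I_n -> T -> R) (lam : 'I_n -> R) (K : T -> T -> R) : Prop := SpectralData {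
  sd_meas_w : forall j, measurable_fun setT (w j) ;
  sd_w_ge0 : forall j x, 0 <= w j x ;
  sd_sum_w : forall x, \sum_j w j x = 1 ;
  sd_int_w : forall j, n%:R * \int[nu]_x w j x = 1 ;
  sd_lam : forall j, lam j = n%:R * \int[nu]_x (sigma x * w j x) ;
  sd_kernel : berezin_kernel nu n%:R K ;
  sd_berezin : forall x,
    (\sum_j lam j * w j x)%:E = (n%:R%:E * \int[nu]_y (sigma y * K x y)%:E)%E }.

Unset Implicit Arguments.

Section trace_bounds.
Context {R : realType} {d : measure_display} {T : measurableType d}.
Context {nu : {finite_measure set T -> \bar R}} {sigma : T -> R} {n : nat}.
Context {w : 'I_n -> T -> R} {lam : 'I_n -> R} {K : T -> T -> R}.
Hypothesis sd : spectral_data nu sigma w lam K.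
Hypothesis sigma_int : nu.-integrable setT (EFin \o sigma).
Hypothesis sigma_ge0 : forall x, 0 <= sigma x.

Let n0 : 0 < n%:R :> R. Proof. exact: bk_pos (sd_kernel sd). Qed.

Let w_le1 j x : `|w j x| <= 1.
Proof.
rewrite ger0_norm ?(sd_w_ge0 sd) // -(sd_sum_w sd x) (bigD1 j) //= lerDl sumr_ge0 //.
by move=> i _; exact: sd_w_ge0 sd _ _.
Qed.

Let int1 : nu.-integrable setT (EFin \o (fun=> 1)).
Proof. exact: finite_measure_integrable_cst. Qed.

Let int_w j : nu.-integrable setT (EFin \o w j).
Proof.
rewrite (_ : w j = fun x => 1 * w j x); last by apply/funext => x; rewrite mul1r.
exact: integrable_mul_bounded int1 (sd_meas_w sd j) (w_le1 j).
Qed.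

Let Rint_w j : \int[nu]_x w j x = n%:R^-1.
Proof. by apply: (mulfI (lt0r_neq0 n0)); rewrite (sd_int_w sd) mulfV ?gt_eqF. Qed.

Let int_sw j : nu.-integrable setT (EFin \o (fun x => sigma x * w j x)).
Proof. exact: integrable_mul_bounded sigma_int (sd_meas_w sd j) (w_le1 j). Qed.

Let Rint_sw j : \int[nu]_x (sigma x * w j x) = n%:R^-1 * lam j.
Proof. by rewrite (sd_lam sd) mulKf ?gt_eqF. Qed.

Lemma sd_lam_ge0 j : 0 <= lam j.
Proof.
rewrite (sd_lam sd) mulr_ge0 // Rintegral_ge0 // => x _.
by rewrite mulr_ge0 // (sd_w_ge0 sd).
Qed.

(** The [n] functions [w j] sum to 1 and each has integral [1 / n]. *)
Lemma sd_mass : \int[nu]_x (1 : R) = 1.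
Proof.
transitivity (\int[nu]_x (\sum_j w j x)).
  by apply: eq_Rintegral => x _; rewrite (sd_sum_w sd).
rewrite Rintegral_rsum // (eq_bigr (fun=> n%:R^-1)) // sumr_const card_ord.
by rewrite -[LHS]mulr_natr mulVf ?gt_eqF.
Qed.

(** The inequality [ln_tangent] at each [t j] is averaged with the weights [w j x] and integrated.
    The points [t j] stay free so that vanishing eigenvalues can be treated too. *)
Lemma integral_lne_le_tangent (t : 'I_n -> R) : (forall j, 0 < t j) ->
  (\int[nu]_x lne (sigma x)%:E <=
    (n%:R^-1 * \sum_j (ln (t j) - 1 + lam j / t j))%:E)%E.
Proof.
move=> t0.
pose r x := \sum_j ((ln (t j) - 1) * w j x + (t j)^-1 * (sigma x * w j x)).
have i1 j : nu.-integrable setT (EFin \o (fun x => (ln (t j) - 1) * w j x)).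
  exact: integrable_scale.
have i2 j : nu.-integrable setT (EFin \o (fun x => (t j)^-1 * (sigma x * w j x))).
  exact: integrable_scale.
have i12 j : nu.-integrable setT
   (EFin \o (fun x => (ln (t j) - 1) * w j x + (t j)^-1 * (sigma x * w j x))).
  exact: integrable_add.
have ri : nu.-integrable setT (EFin \o r) by exact: integrable_rsum.
have -> : n%:R^-1 * \sum_j (ln (t j) - 1 + lam j / t j) = \int[nu]_x r x.
  rewrite Rintegral_rsum // mulr_sumr; apply: eq_bigr => j _.
  rewrite RintegralD // !RintegralZl // Rint_w Rint_sw; field.
  by rewrite !gt_eqF.
rewrite -EFin_Rintegral //; apply: le_integral_measurable.
- by apply: measurable_lne; exact: integrable_measurable sigma_int.
- exact: measurable_int ri.
move=> x; rewrite /lne; case: (leP (sigma x) 0) => [_|s0]; first exact: leNye.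
rewrite lee_fin -[leLHS]mul1r -(sd_sum_w sd x) mulr_suml ler_sum // => j _.
rewrite [X in _ <= X](_ : _ = w j x * (ln (t j) + sigma x / t j - 1)); last by ring.
by rewrite ler_wpM2l ?(sd_w_ge0 sd) // ln_tangent.
Qed.

Lemma integral_lne_le_trace :
  (\int[nu]_x lne (sigma x)%:E <= n%:R^-1%:E * \sum_j lne (lam j)%:E)%E.
Proof.
have [lam0|] := pselect (forall j, 0 < lam j).
  apply: le_trans (integral_lne_le_tangent _ lam0) _.
  under [in leRHS]eq_bigr do rewrite lne_EFin //.
  rewrite sumEFin -EFinM lee_fin ler_pM2l ?invr_gt0 //.
  by apply: ler_sum => j _; rewrite mulfV ?gt_eqF // subrK.
move=> /existsNP[i /negP]; rewrite -leNgt => lami.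
suff -> : (\int[nu]_x lne (sigma x)%:E = -oo)%E by exact: leNye.
have lam0 : lam i = 0 by apply/eqP; rewrite eq_le lami sd_lam_ge0.
apply: le_all_eqNy => A.
pose S := \sum_(j | j != i) (lam j - 1).
(* As [lam i = 0], the term of index [i] is just [ln (t i) - 1], which can be made arbitrarily
   negative. This [t i] makes the bound equal to [A]. *)
pose t j := if j == i then expR (n%:R * A + 1 - S) else 1.
have t0 j : 0 < t j by rewrite /t; case: ifP; rewrite ?expR_gt0.
apply: le_trans (integral_lne_le_tangent t t0) _.
rewrite (bigD1 i) //= lam0 mul0r addr0 /t eqxx expRK.
rewrite (eq_bigr (fun j => lam j - 1)) => [|j ji]; last first.
  by rewrite (negbTE ji) ln1 divr1 sub0r addrC.
rewrite -/S lee_fin [leLHS](_ : _ = A) //; field.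
by rewrite gt_eqF.
Qed.

Lemma trace_le_tangent (s : T -> R) (e : R) : 0 < e ->
  nu.-integrable setT (EFin \o s) -> (forall x, e <= s x) ->
  (n%:R^-1%:E * \sum_j lne (lam j)%:E <=
   \int[nu]_x (ln (s x))%:E - 1 +
   n%:R%:E * \int[nu]_x ((s x)^-1%:E * \int[nu]_y (sigma y * K x y)%:E))%E.
Proof.
move=> e0 si es; have s0 x : 0 < s x by exact: lt_le_trans (es x).
have ms := integrable_measurable _ _ si.
(* Domination by [s + |ln e|]: from below [ln e <= ln s], from above [ln s <= s]. *)
have lnint : nu.-integrable setT (EFin \o (fun x => ln (s x))).
  apply: (@le_integrable _ _ _ nu _ measurableT _ (EFin \o (fun x => s x + `|ln e|))).
  - by apply/measurable_EFinP; exact: measurableT_comp.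
  - move=> x _ /=; rewrite lee_fin [leRHS]ger0_norm; last by rewrite addr_ge0 // ltW.
    rewrite ler_norml.
    apply/andP; split.
      have h1 : ln e <= ln (s x) by rewrite ler_ln ?posrE.
      have h2 : - `|ln e| <= ln e by rewrite lerNl -normrN ler_norm.
      have := s0 x; lra.
    by rewrite (le_trans (ln_lt_id _ (s0 x))) // lerDl.
  - have ci : nu.-integrable setT (EFin \o (fun=> `|ln e|)).
      exact: finite_measure_integrable_cst.
    exact: integrable_add si ci.
(* By [sd_berezin] this is the Berezin transform of [sigma], so the double integral becomes that of
   [v / s]. *)
pose v x := \sum_j lam j * w j x.
have vi : nu.-integrable setT (EFin \o v).
  by apply: integrable_rsum => j; exact: integrable_scale.
have siv x : `|(s x)^-1| <= e^-1.
  rewrite ger0_norm; last by rewrite invr_ge0 ltW.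
  by rewrite lef_pV2 ?posrE.
have svi : nu.-integrable setT (EFin \o (fun x => v x * (s x)^-1)).
  apply: integrable_mul_bounded vi _ siv.
  exact: measurable_inv_gt0.
have v0 x : 0 <= v x.
  by apply: sumr_ge0 => j _; rewrite mulr_ge0 ?sd_lam_ge0 ?(sd_w_ge0 sd).
have -> : (n%:R%:E * \int[nu]_x ((s x)^-1%:E * \int[nu]_y (sigma y * K x y)%:E) =
    \int[nu]_x (v x * (s x)^-1)%:E)%E.
  have IE x : (\int[nu]_y (sigma y * K x y)%:E = (n%:R^-1 * v x)%:E)%E.
    by rewrite EFinM (sd_berezin sd) muleA -EFinM mulVf ?gt_eqF // mul1e.
  under eq_integral do rewrite IE -EFinM.
  rewrite (_ : (fun x => _) = (fun x => (n%:R^-1 * (v x * (s x)^-1))%:E)); last first.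
    by apply/funext => x; rewrite mulrC -mulrA.
  rewrite !EFin_Rintegral //; last exact: integrable_scale.
  by rewrite RintegralZl // -EFinM mulrA mulfV ?gt_eqF // mul1r.
rewrite !EFin_Rintegral // -EFinB -EFinD.
have [lam0|] := pselect (forall j, 0 < lam j); last first.
  move=> /existsNP[i /negP]; rewrite -leNgt => lami.
  (* A zero eigenvalue makes the left-hand side [-oo]. *)
  have -> : (\sum_j lne (lam j)%:E = -oo)%E.
    by apply/esum_eqNyP; exists i; rewrite mem_index_enum le0_lneNy ?lee_fin.
  by rewrite gt0_muleNy ?lte_fin ?invr_gt0 ?leNye.
under eq_bigr do rewrite lne_EFin //.
rewrite sumEFin -EFinM lee_fin.
have -> : n%:R^-1 * \sum_j ln (lam j) = \int[nu]_x (\sum_j ln (lam j) * w j x).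
  rewrite Rintegral_rsum => [|j]; last exact: integrable_scale.
  rewrite mulr_sumr; apply: eq_bigr => j _.
  by rewrite RintegralZl // Rint_w mulrC.
rewrite -[in leRHS]sd_mass -RintegralB // -RintegralD //; last first.
  exact: integrable_sub.
apply: le_Rintegral => //.
- by apply: integrable_rsum => j; exact: integrable_scale.
- by apply: integrable_add => //; exact: integrable_sub.
move=> x _.
(* Since the weights sum to 1, the right-hand integrand is the average of the tangent bounds of
   [ln (lam j)] at the point [s x]. *)
have -> : ln (s x) - 1 + v x * (s x)^-1 =
    \sum_j w j x * (ln (s x) + lam j / s x - 1).
  rewrite -[X in X + _]mul1r -{1}(sd_sum_w sd x) /v !mulr_suml -big_split /=.
  by apply: eq_bigr => j _; ring.
by apply: ler_sum => j _; rewrite mulrC ler_wpM2l ?(sd_w_ge0 sd) // ln_tangent.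
Qed.
End trace_bounds.

(** * Berezin transform *)

(** If [P] failed arbitrarily far out in [A], failing points [u i > i] would form a sequence tending
    to infinity. This gives access to dominated convergence, stated for sequences. *)
Lemma near_within_pinfty_seq (R : realType) (A P : set R) :
  (forall u : nat -> R, (forall i, A (u i)) ->
    u i @[i --> \oo] --> within A (pinfty_nbhs R) -> exists i, P (u i)) ->
  \forall a \near within A (pinfty_nbhs R), P a.
Proof.
move=> H; apply: contrapT => nP.
have {}nP (M : R) : exists x, [/\ M < x, A x & ~ P x].
  apply: contrapT => nx; apply: nP; exists M; split; first exact: num_real.
  by move=> x Mx Ax; apply: contrapT => Px; apply: nx; exists x.
have [u hu] := choice (fun i : nat => nP i%:R).
have [i||i] := H u; last by have [] := hu i.
  by have [] := hu i.
move=> Q [M [_ MQ]].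
suff : \forall i \near \oo, Q (u i) by [].
near=> i; have [iu Au _] := hu i; apply: MQ => //; apply: lt_trans iu.
near: i; exact: nbhs_infty_gtr.
Unshelve. all: by end_near. Qed.

(** For the frame kernel and the measure [c nu], this is the diagonal value of the Toeplitz operator
    with symbol [g] at the frame vector of [y]. *)
Definition berezin {R : realType} {d : measure_display} {T : measurableType d}
    (nu : {measure set T -> \bar R}) (c : R) (K : T -> T -> R) (g : T -> R) (y : T) : R :=
  c * \int[nu]_x (g x * K x y).

Section berezin.
Context {R : realType} {d : measure_display} {T : measurableType d}.
Context {nu : {finite_measure set T -> \bar R}} {c : R} {K : T -> T -> R}.
Hypothesis bk : berezin_kernel nu c K.
Implicit Types f g : T -> R.
Local Notation b := (berezin nu c K).

Let c0 : 0 < c. Proof. exact: bk_pos bk. Qed.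

Let mK1 y : measurable_fun setT (fun x => K x y).
Proof. exact: (measurable_fun_pair1 y (bk_meas bk)). Qed.

Let Kint y : nu.-integrable setT (EFin \o (fun x => K x y)).
Proof.
apply/integrableP; split; first exact/measurable_EFinP.
under eq_integral => x _ do rewrite /= ger0_norm ?(bk_ge0 bk) // (bk_sym bk).
have := bk_int bk y; set I := (\int[nu]_x _)%E.
have I0 : (0 <= I)%E by apply: integral_ge0 => x _; rewrite lee_fin (bk_ge0 bk).
case: I I0 => [r| |] //; first by rewrite ltry.
by rewrite gt0_muley ?lte_fin.
Qed.

Let gK_int g M y : measurable_fun setT g -> (forall x, `|g x| <= M) ->
  nu.-integrable setT (EFin \o (fun x => g x * K x y)).
Proof.
move=> mg gM; rewrite (_ : (fun x => _) = fun x => K x y * g x).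
  exact: integrable_mul_bounded (Kint y) mg gM.
by apply/funext => x; rewrite mulrC.
Qed.

Lemma berezin_EFin g M y : measurable_fun setT g -> (forall x, `|g x| <= M) ->
  (b g y)%:E = (c%:E * \int[nu]_x (g x * K x y)%:E)%E.
Proof. by move=> mg gM; rewrite EFin_Rintegral //; exact: gK_int gM. Qed.

Lemma berezin_ge0 g y : (forall x, 0 <= g x) -> 0 <= b g y.
Proof.
move=> g0; apply: mulr_ge0; first exact: ltW.
by apply: Rintegral_ge0 => x _; rewrite mulr_ge0 ?(bk_ge0 bk).
Qed.

Lemma berezin_cst k y : b (fun=> k) y = k.
Proof.
rewrite /berezin RintegralZl // mulrCA -[RHS]mulr1; congr (_ * _).
have := bk_int bk y; under eq_integral do rewrite (bk_sym bk).
by rewrite EFin_Rintegral // -EFinM => -[].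
Qed.

Lemma le_berezin f g M N y : measurable_fun setT f -> (forall x, `|f x| <= M) ->
  measurable_fun setT g -> (forall x, `|g x| <= N) ->
  (forall x, f x <= g x) -> b f y <= b g y.
Proof.
move=> mf fM mg gN fg; rewrite ler_pM2l //; apply: le_Rintegral => //.
- exact: gK_int fM.
- exact: gK_int gN.
- by move=> x _; rewrite ler_wpM2r ?(bk_ge0 bk).
Qed.

Lemma berezin_le g M y : measurable_fun setT g -> (forall x, `|g x| <= M) -> b g y <= M.
Proof.
move=> mg gM; rewrite -[leRHS](berezin_cst M y).
apply: (le_berezin _ _ M `|M|) => // x.
by apply: le_trans (gM x); exact: ler_norm.
Qed.

Lemma berezin_sum n (h : 'I_n -> T -> R) M y : (forall i, measurable_fun setT (h i)) ->
  (forall i x, `|h i x| <= M) ->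
  b (fun x => \sum_i h i x) y = \sum_i b (h i) y.
Proof.
move=> mh hM; rewrite /berezin -mulr_sumr -Rintegral_rsum.
  by congr (_ * _); apply: eq_Rintegral => x _; rewrite mulr_suml.
by move=> i; exact: gK_int (hM i).
Qed.

Lemma berezinD f g M N y : measurable_fun setT f -> (forall x, `|f x| <= M) ->
  measurable_fun setT g -> (forall x, `|g x| <= N) ->
  b (fun x => f x + g x) y = b f y + b g y.
Proof.
move=> mf fM mg gN; rewrite /berezin -mulrDr -RintegralD //.
- by congr (_ * _); apply: eq_Rintegral => x _; rewrite mulrDl.
- exact: gK_int fM.
- exact: gK_int gN.
Qed.

Lemma berezinZ k g M y : measurable_fun setT g -> (forall x, `|g x| <= M) ->
  b (fun x => k * g x) y = k * b g y.
Proof.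
move=> mg gM; rewrite /berezin [RHS]mulrCA; congr (_ * _).
rewrite -RintegralZl //; last exact: gK_int gM.
by apply: eq_Rintegral => x _; rewrite mulrA.
Qed.

Lemma measurable_berezin g M : measurable_fun setT g -> (forall x, `|g x| <= M) ->
  (forall x, 0 <= g x) -> measurable_fun setT (b g).
Proof.
move=> mg gM g0; apply/measurable_EFinP.
rewrite (_ : _ \o _ = fun y => c%:E * \int[nu]_x (g x * K x y)%:E)%E; last first.
  by apply/funext => y; rewrite /= (berezin_EFin _ _ y mg gM).
apply: measurable_funeM.
apply: (@measurable_fun_fubini_tonelli_G _ _ _ _ _ nu
  (fun z : T * T => (g z.1 * K z.1 z.2)%:E)).
  apply/measurable_EFinP; apply: measurable_funM; last exact: bk_meas bk.
  exact: measurableT_comp.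
by move=> z; rewrite lee_fin mulr_ge0 ?(bk_ge0 bk).
Qed.

Lemma integrable_mul_berezin f g M : nu.-integrable setT (EFin \o f) ->
  measurable_fun setT g -> (forall x, `|g x| <= M) ->
  (forall x, 0 <= g x) ->
  nu.-integrable setT (EFin \o (fun y => f y * b g y)).
Proof.
move=> fi mg gM g0; apply: integrable_mul_bounded fi (measurable_berezin _ _ mg gM g0) _.
by move=> y; rewrite ger0_norm; [exact: berezin_le gM|exact: berezin_ge0].
Qed.

(** Self-adjointness of the Berezin transform: by Tonelli both sides are [c] times the double
    integral of [g x * f y * K x y]. *)
Lemma berezin_duality f g M : nu.-integrable setT (EFin \o f) -> (forall x, 0 <= f x) ->
  measurable_fun setT g -> (forall x, `|g x| <= M) -> (forall x, 0 <= g x) ->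
  (c%:E * \int[nu]_x ((g x)%:E * \int[nu]_y (f y * K x y)%:E) =
  (\int[nu]_y (f y * b g y))%:E)%E.
Proof.
move=> fi f0 mg gM g0; have mf := integrable_measurable _ _ fi.
pose h (z : T * T) := (g z.1 * (f z.2 * K z.1 z.2))%:E.
have mh : measurable_fun setT h.
  apply/measurable_EFinP; apply: measurable_funM; first exact: measurableT_comp.
  by apply: measurable_funM; [exact: measurableT_comp|exact: bk_meas bk].
have h0 z : (0 <= h z)%E by rewrite lee_fin !mulr_ge0 ?(bk_ge0 bk).
transitivity (c%:E * \int[nu]_x \int[nu]_y h (x, y))%E.
  congr (_ * _)%E; apply: eq_integral => x _; rewrite -ge0_integralZl_EFin //.
  - by move=> y _; rewrite lee_fin mulr_ge0 ?(bk_ge0 bk).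
  - apply/measurable_EFinP; apply: measurable_funM => //.
    exact: (measurable_fun_pair2 x (bk_meas bk)).
rewrite (fubini_tonelli _ mh h0) -EFin_Rintegral; last exact: integrable_mul_berezin gM g0.
rewrite -ge0_integralZl_EFin //; first last.
- exact: ltW.
- exact: (measurable_fun_fubini_tonelli_G _ mh h0).
- by move=> y _; apply: integral_ge0 => x _.
apply: eq_integral => y _; rewrite EFinM (berezin_EFin _ _ y mg gM) muleCA.
congr (_ * _)%E; rewrite -ge0_integralZl_EFin //.
- by apply: eq_integral => x _; rewrite /h /= -EFinM mulrCA.
- by move=> x _; rewrite lee_fin mulr_ge0 ?(bk_ge0 bk).
- by apply/measurable_EFinP; apply: measurable_funM.
Qed.

(** Duality with the constant function 1, which the transform fixes. *)
Lemma Rintegral_berezin g M : measurable_fun setT g -> (forall x, `|g x| <= M) ->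
  (forall x, 0 <= g x) -> \int[nu]_y b g y = \int[nu]_x g x.
Proof.
move=> mg gM g0.
have i1 : nu.-integrable setT (EFin \o (fun=> 1 : R)) by exact: finite_measure_integrable_cst.
have := berezin_duality _ _ _ i1 (fun=> ler01) mg gM g0.
under [in RHS]eq_Rintegral do rewrite mul1r.
have Iy x : (\int[nu]_y (1 * K x y)%:E = (c^-1)%:E)%E.
  have E := bk_int bk x; under eq_integral do rewrite mul1r.
  by rewrite -[RHS]mule1 -E muleA -EFinM mulVf ?gt_eqF // mul1e.
under eq_integral do rewrite Iy -EFinM.
have gi : nu.-integrable setT (EFin \o g).
  rewrite (_ : g = fun x => 1 * g x); last by apply/funext => x; rewrite mul1r.
  exact: integrable_mul_bounded i1 mg gM.
rewrite EFin_Rintegral ?RintegralZr //; last first.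
  by rewrite (_ : (fun x => _) = fun x => c^-1 * g x); [exact: integrable_scale|apply/funext => x; rewrite mulrC].
by rewrite -EFinM mulrCA mulfV ?gt_eqF // mulr1 => -[].
Qed.

End berezin.

Lemma indic_bound (R : realType) (T : Type) (B : set T) (x : T) : `|\1_B x : R| <= 1.
Proof. by rewrite indicE ger0_norm ?ler0n // lern1; case: (_ \in _). Qed.

Lemma indic_ge0 (R : realType) (T : Type) (B : set T) (x : T) : 0 <= \1_B x :> R.
Proof. by rewrite indicE ler0n. Qed.

(** * Dominated convergence and tails of integrable functions *)

Section tails.
Context {R : realType} {d : measure_display} {T : measurableType d}.
Context {nu : {measure set T -> \bar R}}.
Variable f : T -> R.
Hypothesis fi : nu.-integrable setT (EFin \o f).
Hypothesis f0 : forall x, 0 <= f x.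

Lemma dominated_Rcvg0 (h : nat -> T -> R) :
  (forall i, measurable_fun setT (h i)) -> (forall x, h i x @[i --> \oo] --> (0 : R)) ->
  (forall i x, `|h i x| <= f x) -> forall e : R, 0 < e ->
  \forall i \near \oo, \int[nu]_x h i x < e.
Proof.
move=> mh h0 hf e e0.
have hi i : nu.-integrable setT (EFin \o h i).
  apply: (@le_integrable _ _ _ nu _ measurableT _ (EFin \o f)) => //.
    exact/measurable_EFinP.
  by move=> x _; rewrite /= lee_fin (le_trans (hf i x)) // ler_norm.
have : (\int[nu]_x (h i x)%:E @[i --> \oo] --> (0 : R)%:E)%E.
  rewrite -[X in _ --> X](integral0 nu setT).
  apply: (@dominated_cvg _ _ _ nu _ measurableT _ _ (EFin \o f)) => //.
  - by move=> i; apply/measurable_EFinP.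
  - by move=> x _; apply: cvg_EFin; [exact: nearW|exact: h0].
  - by move=> i x _; rewrite /= lee_fin.
move=> /fine_cvgP[_] /cvgrPdist_lt /(_ e e0).
apply: filterS => i; rewrite sub0r normrN /= => /(le_lt_trans (ler_norm _)).
by [].
Qed.

(** The functions [max (f - N) 0] tend to 0 pointwise and are dominated by [f]. An unbounded [f] is
    thereby at most a constant plus a function of small integral. *)
Lemma Rintegral_tail (e : R) : 0 < e ->
  exists N : nat, \int[nu]_x Num.max (f x - N%:R) 0 < e.
Proof.
move=> e0.
have mf := integrable_measurable _ _ fi.
have := @dominated_Rcvg0 (fun N x => Num.max (f x - N%:R) 0).
case/(_ _ _ _ e e0).
- by move=> i; apply: measurable_maxr => //; apply: measurable_funB.
- move=> x; apply: cvg_near_cst; near=> N; apply/max_idPr.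
  rewrite subr_le0; apply: ltW; near: N; exact: nbhs_infty_gtr.
- move=> i x; rewrite ger0_norm ?le_max ?lexx ?orbT // ge_max f0 andbT.
  by rewrite lerBlDr lerDl.
by move=> N _ H; exists N; apply: H => /=.
Unshelve. all: by end_near. Qed.

End tails.

(** The sum counts the levels [i h] not above [g], so the middle term is a multiple of [h] exceeding
    [g] by at most one step. *)
Lemma staircase (R : realType) (g h : R) (m : nat) : 0 <= g -> 0 <= h -> g <= m%:R * h ->
  g <= h * \sum_(i < m) (i%:R * h <= g)%R%:R <= g + h.
Proof.
move=> g0 h0 gm.
(* For the induction on [m] the bound on [g] is dropped: either the staircase reaches [g], or all
   [m] levels are counted. *)
suff : [/\ h * \sum_(i < m) (i%:R * h <= g)%R%:R <= m%:R * h,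
   h * \sum_(i < m) (i%:R * h <= g)%R%:R <= g + h &
   g <= h * \sum_(i < m) (i%:R * h <= g)%R%:R \/ m%:R * h <= h * \sum_(i < m) (i%:R * h <= g)%R%:R].
  by case=> _ -> [->|/(le_trans gm) ->].
elim: m {gm} => [|m [IH1 IH2 IH3]].
  by rewrite big_ord0 mulr0 mul0r; split; [|rewrite addr_ge0|right].
rewrite big_ord_recr /= mulrDr -natr1 mulrDl mul1r.
have [mg|mg] := leP (m%:R * h) g.
  rewrite mulr1; split; [lra|lra|].
  by right; case: IH3 => H; lra.
rewrite mulr0 addr0; split; [lra|lra|].
by case: IH3 => H; left; lra.
Qed.

(** * Upper limits of integrals against Berezin transforms *)

Section limit.
Context {R : realType} {d : measure_display} {T : measurableType d}.
Context {nu : {finite_measure set T -> \bar R}} {A : set R} {c : R -> R}.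
Context {K : R -> T -> T -> R}.
Hypothesis bk : forall a, A a -> berezin_kernel nu (c a) (K a).
Local Notation F := (within A (pinfty_nbhs R)).
Local Notation b a := (berezin nu (c a) (K a)).

Variable f : T -> R.
Hypothesis fi : nu.-integrable setT (EFin \o f).
Hypothesis f0 : forall x, 0 <= f x.

Let nearA : \forall a \near F, A a.
Proof. by rewrite near_withinE; apply: filterE. Qed.

Let mf : measurable_fun setT f := integrable_measurable _ _ fi.

(** Localization in a form free of topology; closed sets will have this property. *)
Definition null_outside (C : set T) :=
  measurable C /\ forall y, ~ C y -> b a \1_C y @[a --> F] --> (0 : R).

(** On [C] the transform of the indicator is at most 1; off [C] it tends to 0 pointwise, and its
    product with [f] is dominated by [f]. *)
Lemma berezin_indic_limsup (C : set T) (e : R) : null_outside C -> 0 < e ->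
  \forall a \near F, \int[nu]_y (f y * b a \1_C y) <= \int[nu]_y (f y * \1_C y) + e.
Proof.
move=> [mC C0] e0; apply: near_within_pinfty_seq => u Au ucvg.
have mI : measurable_fun setT (\1_C : T -> R) by exact: measurable_indic.
have mI' : measurable_fun setT (\1_(~` C) : T -> R).
  by apply: measurable_indic; exact: measurableC.
have b01 i y : 0 <= b (u i) \1_C y <= 1.
  rewrite (berezin_ge0 (bk _ (Au i))) => [|x]; last exact: indic_ge0.
  by apply: (berezin_le (bk _ (Au i))) => // x; exact: indic_bound.
have mb i : measurable_fun setT (b (u i) \1_C).
  by apply: (measurable_berezin (bk _ (Au i)) _ 1) => // x; exact: indic_bound.
(* The part of the integrand off [C], whose integral must become smaller than [e]. *)
pose h i y := f y * b (u i) \1_C y * \1_(~` C) y.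
have mh i : measurable_fun setT (h i).
  by apply: measurable_funM => //; apply: measurable_funM.
have hf i y : `|h i y| <= f y.
  have /andP[b0 b1] := b01 i y.
  rewrite /h ger0_norm; last first.
    by apply: mulr_ge0; [exact: mulr_ge0|exact: indic_ge0].
  rewrite -[leRHS]mulr1; apply: ler_pM.
  - exact: mulr_ge0.
  - exact: indic_ge0.
  - by rewrite ler_piMr.
  - exact: le_trans (ler_norm _) (indic_bound _ _ _ _).
have hcvg y : h i y @[i --> \oo] --> (0 : R).
  have [Cy|nCy] := pselect (C y).
    rewrite (_ : (fun i => h i y) = fun=> 0); first exact: cvg_cst.
    by apply/funext => i; rewrite /h indicE memNset ?mulr0.
  rewrite (_ : 0 = f y * 0 * \1_(~` C) y); last by rewrite mulr0 mul0r.
  apply: cvgMl; apply: cvgMr.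
  exact: (cvg_comp _ _ ucvg (C0 _ nCy)).
have [i _ /(_ i (leqnn i)) hi] := dominated_Rcvg0 f fi h mh hcvg hf e e0.
exists i.
have i1 : nu.-integrable setT (EFin \o (fun y => f y * \1_C y)).
  by apply: (integrable_mul_bounded _ _ _ 1 fi mI) => x; exact: indic_bound.
have i2 : nu.-integrable setT (EFin \o h i).
  apply: (@le_integrable _ _ _ nu _ measurableT _ (EFin \o f)) => //.
    exact/measurable_EFinP.
  by move=> x _; rewrite /= lee_fin (le_trans (hf i x)) // ler_norm.
have i3 : nu.-integrable setT (EFin \o (fun y => f y * b (u i) \1_C y)).
  by apply: (integrable_mul_berezin (bk _ (Au i)) _ _ 1) => // x; exact: indic_bound.
apply: le_trans (_ : _ <= \int[nu]_y (f y * \1_C y + h i y)) _.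
  apply: le_Rintegral => //; first exact: integrable_add.
  move=> y _; have /andP[b0 b1] := b01 i y; rewrite /h !indicE in_setC.
  case: (y \in C) => /=; rewrite ?mulr1 ?mulr0 ?addr0 ?add0r //.
  by rewrite ler_piMr.
by rewrite RintegralD // lerD2l ltW.
Qed.

Hypothesis regular : forall (B : set T) (e : R), measurable B -> 0 < e ->
  exists C, [/\ null_outside C, C `<=` B & (nu (B `\` C) < e%:E)%E].

(** Split [B] into [C] and a remainder [D] of small measure. As the transform preserves integrals
    and is at most 1 on indicators, [D] contributes at most [N nu(D)] plus the tail of [f] above
    [N]. Each of the three errors is at most [e / 3]. *)
Lemma berezin_measurable_limsup (B : set T) (e : R) : measurable B -> 0 < e ->
  \forall a \near F, \int[nu]_y (f y * b a \1_B y) <= \int[nu]_y (f y * \1_B y) + e.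
Proof.
move=> mB e0; have e3 : 0 < e / 3 by lra.
have [N hN] := Rintegral_tail f fi f0 _ e3.
(* This bound on [nu D] makes [N nu(D)] at most [e / 3]; the successor avoids division by 0. *)
have eN : 0 < e / 3 / N.+1%:R by rewrite divr_gt0 // ltr0n.
have [C [C0 CB muBC]] := regular B _ mB eN.
have mC : measurable C by case: C0.
pose D := B `\` C; have mD : measurable D by exact: measurableD.
have BE : \1_B = (fun x => \1_C x + \1_D x) :> (T -> R).
  apply/funext => x; rewrite !indicE in_setD.
  have [xC|xC] := boolP (x \in C); first by rewrite mem_set ?addr0 ?andbF //; apply: CB; rewrite -in_setE.
  by rewrite add0r andbT.
have mI S : measurable S -> measurable_fun setT (\1_S : T -> R).
  by move=> mS; exact: measurable_indic.
have bI (S : set T) x : `|\1_S x : R| <= 1 by exact: indic_bound.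
have I0 (S : set T) x : 0 <= \1_S x :> R by exact: indic_ge0.
have iS S : measurable S -> nu.-integrable setT (EFin \o (fun y => f y * \1_S y)).
  by move=> mS; apply: (integrable_mul_bounded _ _ _ _ fi (mI _ mS) (bI S)).
near=> a.
have Aa : A a by near: a; exact: nearA.
have bka := bk _ Aa.
have H : \int[nu]_y (f y * b a \1_C y) <= \int[nu]_y (f y * \1_C y) + e / 3.
  by near: a; exact: berezin_indic_limsup.
pose t y := Num.max (f y - N%:R) 0.
have ti : nu.-integrable setT (EFin \o t).
  apply: (@le_integrable _ _ _ nu _ measurableT _ (EFin \o f)) => //.
    by apply/measurable_EFinP; apply: measurable_maxr => //; apply: measurable_funB.
  move=> x _ /=; rewrite lee_fin ger0_norm ?le_max ?lexx ?orbT // [leRHS]ger0_norm //.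
  by rewrite ge_max f0 andbT lerBlDr lerDl.
have ib S : measurable S -> nu.-integrable setT (EFin \o (fun y => f y * b a \1_S y)).
  by move=> mS; apply: (integrable_mul_berezin bka _ _ _ fi (mI _ mS) (bI S) (I0 S)).
have i1 : nu.-integrable setT (EFin \o (fun=> 1 : R)) by exact: finite_measure_integrable_cst.
have mbD : measurable_fun setT (b a \1_D).
  exact: (measurable_berezin bka _ _ (mI _ mD) (bI D) (I0 D)).
have bD0 y : 0 <= b a \1_D y by exact: (berezin_ge0 bka).
have bD1 y : b a \1_D y <= 1 by exact: (berezin_le bka _ _ _ (mI _ mD) (bI D)).
have ibD : nu.-integrable setT (EFin \o b a \1_D).
  rewrite (_ : b a \1_D = fun x => 1 * b a \1_D x); last by apply/funext => x; rewrite mul1r.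
  by apply: (integrable_mul_bounded _ _ _ 1 i1 mbD) => y; rewrite ger0_norm.
apply: le_trans (_ : _ <= \int[nu]_y (f y * b a \1_C y + (N%:R * b a \1_D y + t y))) _.
  apply: le_Rintegral => //.
  - exact: ib.
  - by apply: integrable_add; [exact: ib|apply: integrable_add => //; exact: integrable_scale].
  move=> y _; rewrite BE (berezinD bka _ _ 1 1) //; try exact: mI.
  rewrite mulrDr lerD2l.
  have fN : f y <= N%:R + t y by rewrite -lerBlDl /t le_max lexx.
  have t0 : 0 <= t y by rewrite le_max lexx orbT.
  apply: le_trans (_ : (N%:R + t y) * b a \1_D y <= _); first by rewrite ler_wpM2r.
  by rewrite mulrDl lerD2l ler_piMr.
rewrite RintegralD //; [|exact: ib|by apply: integrable_add => //; exact: integrable_scale].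
rewrite RintegralD //; last exact: integrable_scale.
rewrite RintegralZl // (Rintegral_berezin bka _ 1 (mI _ mD) (bI D) (I0 D)).
have CBle : \int[nu]_y (f y * \1_C y) <= \int[nu]_y (f y * \1_B y).
  apply: le_Rintegral => //; [exact: iS|exact: iS|].
  by move=> y _; rewrite ler_wpM2l // BE lerDl.
have ND : N%:R * \int[nu]_x \1_D x <= e / 3.
  have -> : \int[nu]_x \1_D x = fine (nu D).
    by rewrite /Rintegral integral_indic // setIT.
  have Dle : fine (nu D) <= e / 3 / N.+1%:R.
    by rewrite -lee_fin fineK ?fin_num_measure // ltW.
  apply: le_trans (_ : N.+1%:R * (e / 3 / N.+1%:R) <= _); last by rewrite mulrC divfK ?pnatr_eq0.
  by apply: ler_pM => //; [exact: fine_ge0|rewrite ler_nat].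
move: H hN CBle ND; rewrite -/t => *; lra.
Unshelve. all: by end_near. Qed.

(** The function [g] lies below a staircase of indicators of its superlevel sets, which exceeds it
    by at most [h]; the bound for measurable sets applies to each of the finitely many
    indicators. *)
Lemma berezin_bounded_limsup (g : T -> R) (M e : R) : measurable_fun setT g ->
  (forall x, 0 <= g x <= M) -> 0 < e ->
  \forall a \near F, \int[nu]_y (f y * b a g y) <= \int[nu]_y (f y * g y) + e.
Proof.
move=> mg gM e0.
have M0 : 0 <= M by have /andP[/le_trans H /H] := gM point.
have If0 : 0 <= \int[nu]_y f y by exact: Rintegral_ge0.
(* Enough levels for the error [h] times the integral of [f], with [h = M / m], to be at most
   [e / 2]. *)
pose m := (Num.truncn (2 * M * (\int[nu]_y f y) / e)).+1.
have m0 : 0 < m%:R :> R by rewrite ltr0n.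
pose h := M / m%:R.
have h0 : 0 <= h by rewrite divr_ge0 // ltW.
have hf : h * (\int[nu]_y f y) <= e / 2.
  have /ltW : 2 * M * (\int[nu]_y f y) / e < m%:R by exact: truncnS_gt.
  rewrite (ler_pdivrMr _ _ e0) => H; rewrite /h mulrAC ler_pdivrMr //; lra.
pose B (i : 'I_m) := [set x | i%:R * h <= g x].
have mB i : measurable (B i).
  rewrite -[X in measurable X]setTI; apply: measurable_fun_ler => //.
(* The [m] errors [e'], each weighted by [h], add up to [M e'], at most [e / 2]; [M + 1] keeps the
   denominator positive when [M = 0]. *)
pose e' := e / (2 * (M + 1)).
have e'0 : 0 < e' by rewrite divr_gt0 //; lra.
have BI i x : \1_(B i) x = (i%:R * h <= g x)%R%:R :> R.
  by rewrite indicE; congr (nat_of_bool _)%:R; apply/idP/idP; rewrite inE.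
have st x : g x <= h * \sum_i \1_(B i) x <= g x + h.
  have /andP[g0 g1] := gM x.
  under eq_bigr do rewrite BI.
  by apply: staircase => //; rewrite /h mulrC divfK ?gt_eqF.
have mI i : measurable_fun setT (\1_(B i) : T -> R) by exact: measurable_indic.
have bI i x : `|\1_(B i) x : R| <= 1 by exact: indic_bound.
have I0 i x : 0 <= \1_(B i) x :> R by exact: indic_ge0.
have mS : measurable_fun setT (fun x => \sum_i \1_(B i) x : R) by exact: measurable_sum.
have S0 x : 0 <= \sum_i \1_(B i) x :> R by exact: sumr_ge0.
have SM x : `|\sum_i \1_(B i) x : R| <= m%:R.
  rewrite ger0_norm // -[leRHS](_ : \sum_(i < m) 1 = m%:R); last by rewrite sumr_const card_ord.
  by apply: ler_sum => i _; exact: le_trans (ler_norm _) (bI i x).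
have hSM x : `|h * \sum_i \1_(B i) x : R| <= h * m%:R.
  by rewrite normrM ger0_norm // ler_wpM2l.
have gMn x : `|g x| <= M by have /andP[g0 g1] := gM x; rewrite ger0_norm.
have iB i : nu.-integrable setT (EFin \o (fun y => f y * \1_(B i) y)).
  exact: (integrable_mul_bounded _ _ _ _ fi (mI i) (bI i)).
near=> a.
have Aa : A a by near: a; exact: nearA.
have bka := bk _ Aa.
have H i : \int[nu]_y (f y * b a \1_(B i) y) <= \int[nu]_y (f y * \1_(B i) y) + e'.
  move: i; near: a; apply: filter_forall => i.
  exact: berezin_measurable_limsup.
have ib i : nu.-integrable setT (EFin \o (fun y => f y * b a \1_(B i) y)).
  exact: (integrable_mul_berezin bka _ _ _ fi (mI i) (bI i) (I0 i)).
have g0 x : 0 <= g x by have /andP[] := gM x.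
apply: le_trans (_ : _ <= \int[nu]_y (h * \sum_i (f y * b a \1_(B i) y))) _.
  apply: le_Rintegral => //.
  - exact: (integrable_mul_berezin bka _ _ _ fi mg gMn g0).
  - by apply: integrable_scale; exact: integrable_rsum.
  move=> y _; rewrite -mulr_sumr [leRHS]mulrCA; apply: ler_wpM2l => //.
  rewrite -(berezin_sum bka _ _ 1) // -(berezinZ bka _ _ m%:R) //.
  apply: (le_berezin bka _ _ M (h * m%:R)) => //.
    exact: measurable_funM.
  by move=> x; have /andP[] := st x.
rewrite RintegralZl //; last exact: integrable_rsum.
rewrite Rintegral_rsum //.
apply: le_trans (_ : h * \sum_i (\int[nu]_y (f y * \1_(B i) y) + e') <= _).
  by rewrite ler_wpM2l // ler_sum.
rewrite big_split /= sumr_const card_ord mulrDr -Rintegral_rsum // -RintegralZl //; last exact: integrable_rsum.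
have L : \int[nu]_x (h * \sum_i (f x * \1_(B i) x)) <= \int[nu]_x (f x * g x) + e / 2.
  apply: le_trans (_ : _ <= \int[nu]_x (f x * g x + h * f x)) _.
    apply: le_Rintegral => //.
    - by apply: integrable_scale; exact: integrable_rsum.
    - apply: integrable_add; [exact: (integrable_mul_bounded _ _ _ _ fi mg gMn)|exact: integrable_scale].
    move=> x _; rewrite -mulr_sumr mulrCA [h * _]mulrC -mulrDr ler_wpM2l //.
    by have /andP[] := st x.
  rewrite RintegralD //; [|exact: (integrable_mul_bounded _ _ _ _ fi mg gMn)|exact: integrable_scale].
  by rewrite RintegralZl // lerD2l.
have L2 : h * (e' *+ m) <= e / 2.
  rewrite -mulr_natr mulrCA /h divfK ?gt_eqF // /e' mulrAC ler_pdivrMr; last by lra.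
  nra.
lra.
Unshelve. all: by end_near. Qed.

End limit.

(** * Szego limit *)

Section log_integral.
Context {R : realType} {d : measure_display} {T : measurableType d}.
Context {nu : {finite_measure set T -> \bar R}} {sigma : T -> R}.
Hypothesis sigma_int : nu.-integrable setT (EFin \o sigma).
Hypothesis sigma_ge0 : forall x, 0 <= sigma x.

Let f x := lne (sigma x)%:E.

Let mf : measurable_fun setT f.
Proof. by apply: measurable_lne; exact: integrable_measurable sigma_int. Qed.

(** The positive part of the logarithm of [sigma] is at most [sigma]. *)
Lemma integral_lne_pos_lty : (\int[nu]_x f^\+ x < +oo)%E.
Proof.
apply: le_lt_trans (_ : _ <= \int[nu]_x (sigma x)%:E)%E _.
  apply: ge0_le_integral => //.
  - exact: measurable_funepos.
  - exact: measurable_int sigma_int.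
  - move=> x _; rewrite funeposE /f /lne; case: (leP (sigma x) 0) => [_|s0].
      by rewrite ge_max leNye lee_fin sigma_ge0.
    by rewrite ge_max !lee_fin sigma_ge0 andbT ln_lt_id.
by rewrite EFin_Rintegral // ltry.
Qed.

Lemma integral_lne_lty : (\int[nu]_x f x < +oo)%E.
Proof.
rewrite integralE; apply: le_lt_trans integral_lne_pos_lty.
by rewrite -[leRHS]sube0 leeB // integral_ge0.
Qed.

Lemma cvg_mine_nat (a : \bar R) : (0 <= a)%E ->
  mine a n%:R%:E @[n --> \oo] --> a.
Proof.
case: a => [r| |] // r0.
  apply: cvg_near_cst; near=> n; apply/min_idPl; rewrite lee_fin ltW //.
  by near: n; exact: nbhs_infty_gtr.
rewrite (_ : (fun n => _) = fun n => (n%:R : R)%:E).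
  by apply/cvgeryP; exact: cvgr_idn.
by apply/funext => n; apply/min_idPr; exact: leey.
Unshelve. all: by end_near. Qed.

(** Truncating [sigma] below at [expR (- n)] keeps the positive part of the logarithm and cuts its
    negative part at [n]; monotone convergence applies to the latter. *)
Lemma integral_ln_truncation (y : R) : (\int[nu]_x f x < y%:E)%E ->
  exists2 e : R, 0 < e & (\int[nu]_x (ln (Num.max (sigma x) e))%:E < y%:E)%E.
Proof.
have Pfin : (\int[nu]_x f^\+ x)%E \is a fin_num.
  rewrite ge0_fin_numE; first exact: integral_lne_pos_lty.
  by apply: integral_ge0.
rewrite integralE -(fineK Pfin); set p := fine _ => Hy.
pose g (n : nat) x := mine (f^\- x)%E (n%:R : R)%:E.
have mg n : measurable_fun setT (g n).
  by apply: measurable_mine => //; exact: measurable_funeneg.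
have g0 n x : (0 <= g n x)%E by rewrite le_min funeneg_ge0 lee_fin ler0n.
have cvgg : (\int[nu]_x g n x @[n --> \oo] --> \int[nu]_x f^\- x)%E.
  rewrite (_ : f^\-%E = fun x => limn (g^~ x)); last first.
    by apply/funext => x; apply/esym/cvg_lim => //; apply: cvg_mine_nat; exact: funeneg_ge0.
  apply: cvg_monotone_convergence => // x _ n m nm.
  by rewrite le_min !ge_min lexx /= lee_fin ler_nat nm orbT.
have [n gn] : exists n, (p%:E - \int[nu]_x g n x < y%:E)%E.
  (* Otherwise the bound for every [n] passes to the limit and contradicts [Hy]. *)
  apply: contrapT => H.
  have : (\int[nu]_x f^\- x <= (p - y)%:E)%E.
    rewrite -(cvg_lim _ cvgg) //; apply: lime_le; first exact: cvgP cvgg.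
    apply: nearW => n; rewrite leNgt; apply/negP => Hn; apply: H; exists n.
    move: Hn; case: (\int[nu]_x g n x)%E => [r| |] //=; last by rewrite ltNyr.
    by rewrite -EFinB !lte_fin => ?; lra.
  move=> {H} J; move: Hy J; case: (\int[nu]_x f^\- x)%E => [r| |] //=.
  by rewrite -EFinB lte_fin lee_fin => ? ?; lra.
exists (expR (- n%:R)); first exact: expR_gt0.
have s0 x : 0 < Num.max (sigma x) (expR (- n%:R)) by rewrite lt_max expR_gt0 orbT.
have E x : (ln (Num.max (sigma x) (expR (- n%:R))))%:E = maxe (f x) (- n%:R)%:E.
  rewrite /f /lne; case: (leP (sigma x) 0) => [sx|sx].
    rewrite (max_idPr _); last exact: le_trans sx (expR_ge0 _).
    by rewrite expRK maxNye.
  rewrite -EFin_max; congr EFin; rewrite /Num.max.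
  rewrite -[in LHS](@ltr_ln _ (sigma x)) ?posrE ?expR_gt0 // expRK.
  by case: ifP; rewrite ?expRK.
under eq_integral do rewrite E.
rewrite integralE.
rewrite (_ : (fun x => _)^\+%E = f^\+%E); last first.
  apply/funext => x; rewrite !funeposE -maxA; congr maxe.
  by apply/max_idPr; rewrite lee_fin oppr_le0.
rewrite (_ : (fun x => _)^\-%E = g n); last first.
  apply/funext => x; rewrite !funenegE /g funenegE oppe_max EFinN oppeK.
  rewrite max_minl; congr mine.
  by apply/max_idPl; rewrite lee_fin ler0n.
by rewrite -(fineK Pfin).
Qed.

End log_integral.

(** For finite [L] the two bounds squeeze [u]; for [L = -oo] the upper bounds are convergence
    itself. *)
Lemma cvge_bounds (R : realType) (F : set_system R) (FF : Filter F) (u : R -> \bar R) (L : \bar R) :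
  (L < +oo)%E -> (\forall a \near F, (L <= u a)%E) ->
  (forall y : R, (L < y%:E)%E -> \forall a \near F, (u a < y%:E)%E) ->
  u a @[a --> F] --> L.
Proof.
case: L => [r| |] // _ Lu uy.
  move=> U /= [e /= e0 rU].
  have re : (r%:E < (r + e)%:E)%E by rewrite lte_fin ltrDl.
  suff : \forall a \near F, U (u a) by [].
  near=> a.
  have h1 : (r%:E <= u a)%E by near: a.
  have h2 : (u a < (r + e)%:E)%E by near: a; exact: uy.
  case: (u a) h1 h2 => [s| |] //; rewrite lee_fin lte_fin => h1 h2.
  by apply: rU; rewrite /= ltr_norml; apply/andP; split; lra.
move=> U /= [M [_ MU]].
have := uy M (ltNyr _); apply: filterS => a; exact: MU.
Unshelve. all: by end_near. Qed.

(** * The limit for abstract kernels and trace bounds *)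

Section szego.
Context {R : realType} {d : measure_display} {T : measurableType d}.
Context {nu : {finite_measure set T -> \bar R}} {A : set R} {c : R -> R}.
Context {K : R -> T -> T -> R}.
Hypothesis bk : forall a, A a -> berezin_kernel nu (c a) (K a).
Context {sigma : T -> R}.
Hypothesis sigma_int : nu.-integrable setT (EFin \o sigma).
Hypothesis sigma_ge0 : forall x, 0 <= sigma x.
Hypothesis regular : forall (B : set T) (e : R), measurable B -> 0 < e ->
  exists C, [/\ @null_outside _ _ _ nu A c K C, C `<=` B & (nu (B `\` C) < e%:E)%E].
Variable tr : R -> \bar R.
Hypothesis tr_ge : forall a, A a -> (\int[nu]_x lne (sigma x)%:E <= tr a)%E.
Hypothesis tr_le : forall a (s : T -> R) (e : R), A a -> 0 < e ->
  nu.-integrable setT (EFin \o s) -> (forall x, e <= s x) ->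
  (tr a <= \int[nu]_x (ln (s x))%:E - 1 +
   (c a)%:E * \int[nu]_x ((s x)^-1%:E * \int[nu]_y (sigma y * K a x y)%:E))%E.
Hypothesis mass1 : \int[nu]_x (1 : R) = 1.

Lemma szego_limit :
  tr a @[a --> within A (pinfty_nbhs R)] --> (\int[nu]_x lne (sigma x)%:E)%E.
Proof.
apply: cvge_bounds.
- exact: integral_lne_lty.
- by rewrite near_withinE; apply: filterE.
move=> y Ly; have [e e0 He] := integral_ln_truncation sigma_int sigma_ge0 y Ly.
set I := (\int[nu]_x _)%E in He.
pose s x := Num.max (sigma x) e.
have es x : e <= s x by rewrite le_max lexx orbT.
have s0 x : 0 < s x by exact: lt_le_trans (es x).
have si : nu.-integrable setT (EFin \o s).
  have ci : nu.-integrable setT (EFin \o (fun=> e)) by exact: finite_measure_integrable_cst.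
  apply: (@le_integrable _ _ _ nu _ measurableT _ (EFin \o (fun x => sigma x + e))).
  - by apply/measurable_EFinP; apply: measurable_maxr => //; exact: integrable_measurable sigma_int.
  - move=> x _; rewrite /= lee_fin ger0_norm; last exact: ltW.
    rewrite ger0_norm; last by rewrite addr_ge0 // ltW.
    by rewrite ge_max lerDl ltW // lerDr sigma_ge0.
  - exact: integrable_add.
pose g x := (s x)^-1.
have mg : measurable_fun setT g.
  by apply: measurable_inv_gt0 => //; exact: integrable_measurable si.
have g0 x : 0 <= g x by rewrite invr_ge0 ltW.
have gM x : 0 <= g x <= e^-1 by rewrite g0 /g lef_pV2 ?posrE /= ?es.
have gMn x : `|g x| <= e^-1 by have /andP[_ ?] := gM x; rewrite ger0_norm.
(* From [sigma <= s] and total mass 1; this compensates the term [- 1] of the trace bound. *)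
have fg1 : \int[nu]_x (sigma x * g x) <= 1.
  rewrite -mass1; apply: le_Rintegral => //.
  - exact: (integrable_mul_bounded _ _ _ _ sigma_int mg gMn).
  - exact: finite_measure_integrable_cst.
  - by move=> x _; rewrite ler_pdivrMr // mul1r le_max lexx.
(* Room below [y] to absorb the error of the Berezin limit. *)
have [eta eta0 Heta] : exists2 eta : R, 0 < eta & (I + eta%:E < y%:E)%E.
  move: He; case: (I) => [r| |] //; last by exists 1; rewrite ?ltNyr.
  by rewrite lte_fin => ry; exists ((y - r) / 2); [lra|rewrite -EFinD lte_fin; lra].
near=> a.
have Aa : A a by near: a; rewrite near_withinE; apply: filterE.
apply: le_lt_trans (tr_le a s e Aa e0 si es) _.
rewrite (berezin_duality (bk _ Aa) _ _ _ sigma_int sigma_ge0 mg gMn g0).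
have Q : \int[nu]_x (sigma x * berezin nu (c a) (K a) g x) <= 1 + eta.
  apply: le_trans (_ : \int[nu]_x (sigma x * g x) + eta <= _); last by rewrite lerD2r.
  by near: a; exact: (berezin_bounded_limsup bk _ sigma_int sigma_ge0 regular _ e^-1).
apply: le_lt_trans Heta; rewrite -addeA; apply: leeD2l.
by rewrite -EFinN -EFinD lee_fin; lra.
Unshelve. all: by end_near. Qed.
End szego.

(** * Integration against a multiple of a measure *)

Section scaled_measure.
Context {R : realType} {d : measure_display} {T : measurableType d}.
Context {mu nu : {measure set T -> \bar R}} {c : R}.
Hypothesis c0 : 0 <= c.
Hypothesis muE : forall B, measurable B -> mu B = (c%:E * nu B)%E.

Lemma ge0_integral_scaled (D : set T) (f : T -> \bar R) : measurable D ->
  measurable_fun D f -> (forall x, D x -> (0 <= f x)%E) ->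
  (\int[mu]_(x in D) f x = c%:E * \int[nu]_(x in D) f x)%E.
Proof.
move=> mD mf f0; rewrite -[c]/((NngNum c0)%:num) -ge0_integral_mscale //.
by apply: eq_measure_integral => B mB _; exact: muE.
Qed.

Lemma integrable_scaled (f : T -> \bar R) :
  nu.-integrable setT f -> mu.-integrable setT f.
Proof.
move=> /integrableP[mf fi]; apply/integrableP; split => //.
rewrite ge0_integral_scaled //; last exact: measurableT_comp.
by rewrite lte_mul_pinfty // lee_fin.
Qed.

Lemma Rintegral_scaled (f : T -> R) : nu.-integrable setT (EFin \o f) ->
  \int[mu]_x f x = c * \int[nu]_x f x.
Proof.
move=> fi; have fmu := integrable_scaled _ fi.
have mf := measurable_int _ fi.
apply: EFin_inj; rewrite -EFin_Rintegral // EFinM -EFin_Rintegral //.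
rewrite [LHS]integralE [X in _ = (_ * X)%E]integralE !ge0_integral_scaled //.
- by apply/esym/muleBr => //; exact: integrable_add_def fi.
- exact: measurable_funeneg.
- exact: measurable_funepos.
Qed.

End scaled_measure.

(** * Kernel and spectral data of a frame *)

Section frame_spectral_data.
Context {R : realType} {X : ptopologicalType} {H : vectType R[i]}.
Context {ip : {dot H for Num.conj}} {mu : {measure set (borel X) -> \bar R}}.
Context {nu : {finite_measure set (borel X) -> \bar R}} {k : X -> H} {sigma : X -> R}.
Let n := \dim {: H}.
Let K (x y : borel X) : R := complex.Re (`|ip (k x) (k y)| ^+ 2).
(** The symbol is nonnegative only almost everywhere, whereas the abstract results ask for it
    everywhere; the positive part gives the same integrals. *)
Let sigma' (x : borel X) : R := Num.max (sigma x) 0.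
Hypothesis frame : normalized_parseval_frame ip mu k.
Hypothesis muE : forall B : set (borel X), measurable B -> mu B = (n%:R%:E * nu B)%E.

(** [X] has a point, and an empty sum cannot have the value 1 given by Parseval's identity there. *)
Lemma dim_gt0 : 0 < n%:R :> R.
Proof.
have [e eo] := exists_orthonormal ip.
have := sum_sqr_frame ip mu k frame e point eo; rewrite ltr0n -/n.
case: (posnP n) e eo => // n0; rewrite -/n n0 => e eo.
by rewrite big_ord0 => /esym/eqP; rewrite oner_eq0.
Qed.
Let n_ge0 : 0 <= n%:R :> R. Proof. exact: ltW dim_gt0. Qed.

Let nuE (B : set (borel X)) : measurable B -> nu B = (n%:R^-1%:E * mu B)%E.
Proof.
by move=> mB; rewrite muE // muleA -EFinM mulVf ?mul1e // gt_eqF // dim_gt0.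
Qed.

Lemma frame_berezin_kernel : berezin_kernel nu n%:R K.
Proof.
split.
- exact: dim_gt0.
- exact: measurable_frame_kernel frame.
- by move=> x y; exact: Re_sqr_norm_ge0.
- by move=> x y; rewrite /K (dot_conj ip (k x)) Re_sqr_normJ.
- move=> x; rewrite -(ge0_integral_scaled n_ge0 muE) //.
  + by rewrite (integral_sqr_frame ip mu k frame) (frame_normalized frame).
  + by apply/measurable_EFinP; exact: (measurable_sqr_frame ip mu k frame).
  + by move=> y _; rewrite lee_fin Re_sqr_norm_ge0.
Qed.

Hypothesis sigma_L1 : nu.-integrable [set: borel X] (fun x => (sigma x)%:E).
Hypothesis sigma_ge0 : {ae nu, forall x, 0 <= sigma x}.

Lemma integrable_pos_part : nu.-integrable [set: borel X] (EFin \o sigma').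
Proof.
have mf : measurable_fun [set: borel X] sigma := integrable_measurable _ _ sigma_L1.
apply: (@le_integrable _ _ _ nu _ measurableT _ (EFin \o sigma)) => //.
  by apply/measurable_EFinP; apply: measurable_maxr.
move=> x _ /=; rewrite lee_fin ger0_norm ?le_max ?lexx ?orbT //.
by rewrite ge_max ler_norm normr_ge0.
Qed.

Lemma frame_spectral_data : exists (w : 'I_n -> borel X -> R) (lam : 'I_n -> R),
  spectral_data nu sigma' w lam K /\
  trace_log (toeplitz ip mu k sigma) = (\sum_j lne (lam j)%:E)%E.
Proof.
have sigma_mu := integrable_scaled n_ge0 muE _ sigma_L1.
have [e [lam [eo lamE berE trE]]] := toeplitz_spectral_data ip mu k sigma frame sigma_mu.
have int_mu f := integrable_symbol_sqr_frame ip mu k sigma frame sigma_mu f.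
have ninv_ge0 : 0 <= n%:R^-1 :> R by rewrite invr_ge0.
have int_nu f := integrable_scaled ninv_ge0 nuE _ (int_mu f).
have msq f := measurable_sqr_frame ip mu k frame f.
have ms' := integrable_measurable _ _ integrable_pos_part.
have int_eq f : (\int[nu]_x (sigma x * complex.Re (`|ip f (k x)| ^+ 2))%:E =
    \int[nu]_x (sigma' x * complex.Re (`|ip f (k x)| ^+ 2))%:E)%E.
  apply: ae_eq_integral => //.
  - exact: measurable_int (int_nu f).
  - by apply/measurable_EFinP; exact: measurable_funM.
  - apply: filterS sigma_ge0; first exact: (ae_filter_ringOfSetsType nu).
    move=> x sx _; rewrite /sigma' (max_idPl _) //.
have int_nu' f : nu.-integrable setT
    (EFin \o (fun x => sigma' x * complex.Re (`|ip f (k x)| ^+ 2))).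
  apply: le_integrable (int_nu f) => //.
    by apply/measurable_EFinP; exact: measurable_funM.
  move=> x _ /=; rewrite lee_fin !normrM ler_wpM2r //.
  by rewrite ger0_norm ?le_max ?lexx ?orbT // ge_max ler_norm normr_ge0.
have mu_nu f : \int[mu]_x (sigma x * complex.Re (`|ip f (k x)| ^+ 2)) =
    n%:R * \int[nu]_x (sigma' x * complex.Re (`|ip f (k x)| ^+ 2)).
  by rewrite (Rintegral_scaled n_ge0 muE) // /Rintegral int_eq.
exists (fun j (x : borel X) => complex.Re (`|ip (e j) (k x)| ^+ 2)), lam; split => //.
split.
- by move=> j; exact: msq.
- by move=> j x; exact: Re_sqr_norm_ge0.
- by move=> x; exact: sum_sqr_frame frame e x eo.
- move=> j; have := integral_sqr_frame ip mu k frame (e j).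
  rewrite eo eqxx (ge0_integral_scaled n_ge0 muE) //.
  (* An infinite integral would have an infinite product with the positive number [n], not 1. *)
  + rewrite /Rintegral; case: (\int[nu]_x _)%E => [r| |] /=.
    * by rewrite -EFinM => -[].
    * by rewrite gt0_muley ?lte_fin ?dim_gt0.
    * by rewrite gt0_muleNy ?lte_fin ?dim_gt0.
  + by apply/measurable_EFinP; exact: msq.
  + by move=> x _; rewrite lee_fin Re_sqr_norm_ge0.
- by move=> j; rewrite lamE mu_nu.
- exact: frame_berezin_kernel.
- move=> x; rewrite berE mu_nu EFinM; congr (_ * _)%E.
  by rewrite EFin_Rintegral //; exact: int_nu'.
Qed.

End frame_spectral_data.

(** Outer regularity of the complement of [B] gives an open [U] of nearly the same finite measure;
    [C] is the complement of [U], and [B] minus [C] is the excess of [U]. *)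
Lemma radon_inner_closed (R : realType) (X : ptopologicalType)
    (nu : {finite_measure set (borel X) -> \bar R}) (B : set (borel X)) (e : R) :
  radon_measure nu -> measurable B -> 0 < e ->
  exists C : set X, [/\ closed C, C `<=` B & (nu (B `\` C) < e%:E)%E].
Proof.
move=> [_ outer _] mB e0.
have mBc : measurable (~` B) by exact: measurableC.
have fB : nu (~` B) \is a fin_num by exact: fin_num_measure.
have : (ereal_inf [set nu U | U in [set U : set X | open U /\ ~` B `<=` U]] <
    nu (~` B) + e%:E)%E.
  by rewrite -outer // lteDl // lte_fin.
move=> /ereal_inf_lt[_ [U [oU BU] <-] UB].
have mU : measurable (U : set (borel X)) by exact: sub_sigma_algebra.
exists (~` U); split.
- exact: open_closedC.
- by rewrite -[B]setCK; exact: subsetC.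
have -> : B `\` ~` U = U `\` ~` B.
  by rewrite !setDE !setCK setIC.
rewrite measureD //; last by rewrite ltey_eq fin_num_measure.
have -> : U `&` ~` B = ~` B by apply/seteqP; split => [x []//|x Bx]; split => //; exact: BU.
by rewrite lteBlDr // addeC.
Qed.

Theorem theorem4p4 (R : realType) (X : ptopologicalType)
  (compactX : compact [set: X]) (hausdorffX : hausdorff_space X)
  (* the set of parameter values, along which alpha tends to +oo *)
  (A : set R) (unboundedA : forall M : R, exists2 alpha, A alpha & M < alpha)
  (H : R -> vectType R[i])
  (ip : forall alpha : R, {dot (H alpha) for Num.conj})
  (k : forall alpha : R, X -> H alpha)
  (nua : R -> {measure set (borel X) -> \bar R})
  (nu : {finite_measure set (borel X) -> \bar R})
  (sigma : X -> R)
  (c := fun alpha : R => \dim {: H alpha})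
  (frame : forall alpha, A alpha ->
    normalized_parseval_frame (ip alpha) (nua alpha) (k alpha))
  (radon_nu : radon_measure nu)
  (nuaE : forall alpha, A alpha -> forall B : set (borel X), measurable B ->
    nua alpha B = ((c alpha)%:R%:E * nu B)%E)
  (localization : forall (x : X) (U : set X),
    nbhs x U -> measurable (U : set (borel X)) ->
    (\int[nua alpha]_(y in ~` (U : set (borel X)))
       (complex.Re (`|ip alpha (k alpha x) (k alpha y)| ^+ 2))%:E)%E
      @[alpha --> within A (pinfty_nbhs R)] --> (0 : \bar R)%E)
  (sigma_L1 : nu.-integrable [set: borel X] (fun x => (sigma x)%:E))
  (sigma_ge0 : {ae nu, forall x, 0 <= sigma x}) :
  [/\ (* the integral on the right-hand side is well defined and is not +oo *)
      (\int[nu]_(x in [set: borel X]) (fun y => lne (sigma y)%:E)^\+ x < +oo)%E,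
      (\int[nu]_(x in [set: borel X]) lne (sigma x)%:E < +oo)%E
    & (((c alpha)%:R^-1)%:E *
         trace_log (toeplitz (ip alpha) (nua alpha) (k alpha) sigma))%E
        @[alpha --> within A (pinfty_nbhs R)] -->
      (\int[nu]_(x in [set: borel X]) lne (sigma x)%:E)%E].
Proof.
pose sigma' (x : borel X) : R := Num.max (sigma x) 0.
pose K a (x y : borel X) : R := complex.Re (`|ip a (k a x) (k a y)| ^+ 2).
(* This holds at every point, since [lne] is [-oo] on all nonpositive numbers. *)
have lneE x : lne (sigma x)%:E = lne (sigma' x)%:E.
  rewrite /sigma' /lne; have [s0|s0] := leP (sigma x) 0.
    by rewrite lexx.
  by rewrite leNgt s0.
have s'int : nu.-integrable [set: borel X] (EFin \o sigma').
  exact: integrable_pos_part sigma_L1.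
have s'0 x : 0 <= sigma' x by rewrite le_max lexx orbT.
have lneF : (fun x : borel X => lne (sigma x)%:E) = (fun x => lne (sigma' x)%:E).
  by apply/funext => x; exact: lneE.
rewrite lneF.
split; [exact: integral_lne_pos_lty|exact: integral_lne_lty|].
have data a (Aa : A a) := frame_spectral_data (frame a Aa) (nuaE a Aa) sigma_L1 sigma_ge0.
have bk a : A a -> berezin_kernel nu (c a)%:R (K a).
  by move=> Aa; exact: frame_berezin_kernel (frame a Aa) (nuaE a Aa).
apply: (szego_limit (c := fun a => (c a)%:R) bk s'int s'0).
- move=> B e mB e0; have [C [cC CB BC]] := radon_inner_closed _ _ _ _ _ radon_nu mB e0.
  exists C; split => //; split.
    by rewrite -[C]setCK; apply: measurableC; apply: sub_sigma_algebra; exact: closed_openC.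
  move=> y nCy; have mC : measurable (C : set (borel X)).
    by rewrite -[C]setCK; apply: measurableC; apply: sub_sigma_algebra; exact: closed_openC.
  have nbhsC : nbhs (y : X) (~` C) by apply: open_nbhs_nbhs; split => //; exact: closed_openC.
  have := localization y (~` C) nbhsC (measurableC mC); rewrite setCK => loc.
  have bE a : A a -> (\int[nua a]_(x in (C : set (borel X))) (K a y x)%:E =
      (berezin nu (c a)%:R (K a) \1_C y)%:E)%E.
    move=> Aa; have bka := bk a Aa.
    have mK : measurable_fun setT (K a y).
      exact: (measurable_sqr_frame _ _ _ (frame a Aa)).
    rewrite (berezin_EFin bka \1_C 1); [|exact: measurable_indic|exact: indic_bound].
    rewrite (ge0_integral_scaled _ (nuaE a Aa)) //; last 2 first.
    - by apply: measurable_funTS; exact/measurable_EFinP.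
    - by move=> x _; rewrite lee_fin; exact: bk_ge0 bka _ _.
    congr (_ * _)%E; rewrite integral_mkcond; apply: eq_integral => x _.
    rewrite patchE indicE (bk_sym bka x); case: ifP => xC; rewrite ?mul1r ?mul0r //.
  have : (berezin nu (c a)%:R (K a) \1_C y)%:E @[a --> within A (pinfty_nbhs R)] --> (0 : R)%:E.
    apply: cvg_trans loc; apply: near_eq_cvg.
    by rewrite near_withinE; apply: filterE => a Aa; rewrite bE.
  by move=> /fine_cvgP[].
- move=> a Aa; have [w [lam [sd ->]]] := data a Aa.
  exact: integral_lne_le_trace sd s'int s'0.
- move=> a s e Aa e0 si es; have [w [lam [sd ->]]] := data a Aa.
  exact: (trace_le_tangent sd s'0 s e e0 si es).
(* The measure [nu] does not depend on the parameter, so its mass can be read off at any one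
   value. *)
- have [a Aa _] := unboundedA 0; have [w [lam [sd _]]] := data a Aa.
  exact: sd_mass sd.
Qed.
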